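(* Assume Assumptions 1 and 2, fix $T\ge1$, and let $\pi_0$ either admit a density or be a point mass $\delta_{x_0}$. Set $J^T_T\equiv0$ and for $t=T-1,\dots,0$ define $$J^T_t(\pi)=\inf_{Q\in\mathcal Q_c}\Big(\tfrac1T c(\pi,Q)+\sum_{m=1}^M J^T_{t+1}\big(\hat\pi(m,\pi,Q)\big)\,\pi(Q^{-1}(m))\Big),$$ (terms with $\pi(Q^{-1}(m))=0$ being zero). Then for every $t\ge1$ and $\pi\in\mathcal S$, and for $t=0$ and $\pi\in\mathcal S\cup\{\pi_0\}$, the infimum is attained by some $Q\in\mathcal Q_c$. Moreover, $J^T_t$ is continuous on $\mathcal S$.
   Context: Assumption 1: the source is $x_{t+1}=f(x_t,w_t)$ with $f:\mathbb R^d\times\mathbb R^d\to\mathbb R^d$ Borel, $\{w_t\}$ i.i.d. and independent of $x_0\sim\pi_0$; for each $x$ the law of $f(x,w_0)$ has a density $\phi(\cdot|x)$ which is strictly positive everywhere, bounded by $C$ and $C_1$-Lipschitz, uniformly in $x$. Assumption 2: $c_0:\mathbb R^d\times\mathbb U\to\mathbb R$ is nonnegative, bounded and continuous, and the reconstruction set $\mathbb U$ is compact. $\mathcal S$: probability measures on $\mathbb R^d$ with density bounded by $C$ and $C_1$-Lipschitz, with the weak (equivalently, total variation) topology. $M$-cell quantizer: Borel $Q:\mathbb R^d\to\{1,\dots,M\}$; $\mathcal Q_c$: quantizers with all cells $Q^{-1}(i)$ convex, topologized by: fix $P$ with strictly positive density, identify $Q,Q'$ if $PQ=PQ'$, and $Q_n\to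 Q$ iff $PQ_n\to PQ$ weakly, where $PQ(A\times\{i\})=P(A\cap Q^{-1}(i))$. Cost: $c(\pi,Q)=\sum_{i=1}^M\inf_{u\in\mathbb U}\int_{Q^{-1}(i)}c_0(x,u)\pi(dx)$. Filter update: $\hat\pi(m,\pi,Q)$ is the probability measure with density $z\mapsto\pi(Q^{-1}(m))^{-1}\int_{Q^{-1}(m)}\phi(z|x)\pi(dx)$ when $\pi(Q^{-1}(m))>0$. *)

(* Defs.v *)
From HB Require Import structures.
From mathcomp Require Import all_boot all_order all_algebra.
From mathcomp Require Import all_classical all_reals all_analysis.
Set Implicit Arguments. Unset Strict Implicit. Unset Printing Implicit Defensive.
Import Order.TTheory GRing.Theory Num.Theory.
Local Open Scope classical_set_scope.
Local Open Scope ring_scope.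

(* The state space R^d is represented by d.-tuple R, carrying the product
   (= Borel) sigma-algebra provided by MathComp-Analysis. *)
Notation Rd R d := (d.-tuple R).

Section defs.
Variables (R : realType) (d : nat).
Local Notation X := (Rd R d).

Definition eucl (x y : X) : R :=
  Num.sqrt (\sum_(i < d) (tnth x i - tnth y i) ^+ 2).

Definition lipschitz_eucl (g : X -> R) (L : R) : Prop :=
  forall x y, `|g x - g y| <= L * eucl x y.

Definition box (a b : X) : set X :=
  [set x | forall i, tnth a i <= tnth x i <= tnth b i].

(* lam is Lebesgue measure on the Borel sets of R^d (uniquely determined
   by its values on boxes). *)
Definition is_lebesgue (lam : {measure set X -> \bar R}) : Prop :=
  forall a b : X, (forall i, tnth a i <= tnth b i) ->
    lam (box a b) = (\prod_(i < d) (tnth b i - tnth a i))%:E.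

Definition has_density (lam : set X -> \bar R) (mu : set X -> \bar R)
    (g : X -> R) : Prop :=
  measurable_fun [set: X] g /\ (forall x, 0 <= g x) /\
  forall A, measurable A -> mu A = (\int[lam]_(x in A) (g x)%:E)%E.

Definition inS (lam : set X -> \bar R) (C C1 : R) (mu : set X -> \bar R) : Prop :=
  mu [set: X] = 1%E /\
  exists g, has_density lam mu g /\ (forall x, g x <= C) /\ lipschitz_eucl g C1.

Definition convex_cell (A : set X) : Prop :=
  forall x y (t : R), A x -> A y -> 0 <= t <= 1 ->
    A [tuple (1 - t) * tnth x i + t * tnth y i | i < d].

Definition cell M (Q : X -> 'I_M) (i : 'I_M) : set X := Q @^-1` [set i].

Definition inQc M (Q : X -> 'I_M) : Prop :=
  forall i, measurable (cell Q i) /\ convex_cell (cell Q i).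

Variables (U : topologicalType).

Definition jcont (c0 : X -> U -> R) : Prop :=
  forall x u (e : R), 0 < e -> exists2 del : R, 0 < del &
    exists2 N, nbhs u N & forall y v, eucl x y < del -> N v ->
      `|c0 y v - c0 x u| < e.

Local Open Scope ereal_scope.

Definition cost (c0 : X -> U -> R) M (pi : set X -> \bar R) (Q : X -> 'I_M)
  : \bar R :=
  \sum_(i < M) ereal_inf [set \int[pi]_(x in cell Q i) (c0 x u)%:E | u in [set: U]].

(* filter update \hat pi(m, pi, Q); phi x z is the density at z of the law
   of f(x, w_0). Only meaningful when pi (cell Q m) > 0. *)
Definition filter_update (lam : set X -> \bar R) (phi : X -> X -> R) M
    (m : 'I_M) (pi : set X -> \bar R) (Q : X -> 'I_M) : set X -> \bar R :=
  fun A => ((fine (pi (cell Q m)))^-1)%:E *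
    \int[lam]_(z in A) (\int[pi]_(x in cell Q m) (phi x z)%:E).

Definition objective (lam : set X -> \bar R) (phi : X -> X -> R)
    (c0 : X -> U -> R) M (T : nat) (V : (set X -> \bar R) -> \bar R)
    (pi : set X -> \bar R) (Q : X -> 'I_M) : \bar R :=
  (T%:R^-1)%:E * cost c0 pi Q +
  \sum_(m < M) (if pi (cell Q m) == 0 then 0
                else V (filter_update lam phi m pi Q) * pi (cell Q m)).

(* Jrem k = J^T_{T-k} *)
Fixpoint Jrem (lam : set X -> \bar R) (phi : X -> X -> R)
    (c0 : X -> U -> R) M (T : nat) (k : nat) (pi : set X -> \bar R) : \bar R :=
  match k with
  | 0%N => 0
  | k'.+1 => ereal_inf [set objective lam phi c0 T (Jrem lam phi c0 M T k') pi Q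
                         | Q in [set Q : X -> 'I_M | inQc Q]]
  end.

Definition J (lam : set X -> \bar R) (phi : X -> X -> R)
    (c0 : X -> U -> R) M (T t : nat) : (set X -> \bar R) -> \bar R :=
  Jrem lam phi c0 M T (T - t).

End defs.

(* Main.v *)
(** Unnormalised filters depend on the prior and on the cells in a Lipschitz way for
    total variation, so by backward induction each cost-to-go J is bounded and
    Lipschitz in total variation on all probability measures, and the objective changes
    by at most K * pi(Q <> Q') when Q is replaced by Q'.  For attainment, two disjoint
    convex sets are separated by a hyperplane, so along a subsequence a minimising
    sequence of quantizers has converging separating hyperplanes (up to escape to
    infinity); off the union of the limit hyperplanes, which is Lebesgue-null, the
    quantizers converge pointwise to a quantizer with polyhedral cells.  For a point
    mass the objective does not depend on Q.  The Lipschitz hypothesis on the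
    transition densities is used to make them jointly measurable. *)

Require Import Defs.
From HB Require Import structures.
From mathcomp Require Import all_boot all_order all_algebra.
From mathcomp Require Import all_classical all_reals all_analysis.
From mathcomp Require Import measurable_realfun ring lra.
Import Order.TTheory GRing.Theory Num.Theory.
Import numFieldNormedType.Exports.
Local Open Scope classical_set_scope.
Local Open Scope ring_scope.
Set Implicit Arguments. Unset Strict Implicit. Unset Printing Implicit Defensive.

(** The filter update divides by the mass of a cell, which may be arbitrarily small: when the prior
    moves by dl, a filter can move by 2 dl / mass. The objective multiplies the value back by that
    same mass, and this cancellation is what keeps the Lipschitz constants finite. Working on all
    probability measures avoids tracking whether updated filters stay in S. Hyperplanes are unit
    vectors of R^(d+1) acting on homogeneous coordinates (1, x). The sphere is compact, and its two
    points with zero linear part stand for hyperplanes that have escaped to infinity; they also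
    separate empty cells. Convergence off a null set prescribes no values on that set, while the
    cells of the limit must be convex everywhere; hence the tie-breaking rule. For joint
    measurability, phi(x, z) is recovered as the limit of the probability that f(x, w_0) falls in a
    small cube around z, divided by the volume of the cube. *)

Section dot_product.
Context {R : realType} {n : nat}.
Implicit Types a u v : 'rV[R]_n.

Definition dotp a v : R := \sum_i a 0 i * v 0 i.

Lemma dotpC a v : dotp a v = dotp v a.
Proof. by apply: eq_bigr => i _; rewrite mulrC. Qed.

Lemma dotpDr a u v : dotp a (u + v) = dotp a u + dotp a v.
Proof. by rewrite -big_split; apply: eq_bigr => i _; rewrite mxE mulrDr. Qed.

Lemma dotpZr a c v : dotp a (c *: v) = c * dotp a v.
Proof. by rewrite big_distrr; apply: eq_bigr => i _; rewrite mxE mulrCA. Qed.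

Lemma dotpDl a u v : dotp (a + u) v = dotp a v + dotp u v.
Proof. by rewrite dotpC dotpDr !(dotpC v). Qed.

Lemma dotpZl a c v : dotp (c *: a) v = c * dotp a v.
Proof. by rewrite dotpC dotpZr dotpC. Qed.

Lemma dotpNr a v : dotp a (- v) = - dotp a v.
Proof. by rewrite -scaleN1r dotpZr mulN1r. Qed.

Lemma dotpNl a v : dotp (- a) v = - dotp a v.
Proof. by rewrite dotpC dotpNr dotpC. Qed.

Lemma dotpp_ge0 v : 0 <= dotp v v.
Proof. by apply: sumr_ge0 => i _; rewrite -expr2 sqr_ge0. Qed.

Lemma dotpp_eq0 v : (dotp v v == 0) = (v == 0).
Proof.
apply/eqP/eqP => [/eqP|->]; last by rewrite /dotp big1// => i _; rewrite mxE mul0r.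
rewrite psumr_eq0 => [/allP h|i _]; last by rewrite -expr2 sqr_ge0.
apply/rowP => i; have := h i (mem_index_enum _).
by rewrite -expr2 sqrf_eq0 mxE => /eqP.
Qed.

Lemma dotpp_gt0 v : (0 < dotp v v) = (v != 0).
Proof. by rewrite lt_def dotpp_eq0 dotpp_ge0 andbT. Qed.

Lemma continuous_dotpl v : continuous (fun a => dotp a v).
Proof.
move=> a; apply: (@cvg_big _ _ +%R _ _ _ _ (nbhs a)) => [|i _]; first exact: add_continuous.
by apply: cvgM; [exact: coord_continuous|exact: cvg_cst].
Qed.

Lemma continuous_dotpp : continuous (fun v => dotp v v).
Proof.
move=> a; apply: (@cvg_big _ _ +%R _ _ _ _ (nbhs a)) => [|i _]; first exact: add_continuous.
by apply: cvgM; exact: coord_continuous.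
Qed.

End dot_product.

(** * Separation of disjoint convex sets by a hyperplane *)

Lemma small_perturbation (R : realType) (I : eqType) (s : seq I) (p q : I -> R) :
  (forall i, i \in s -> 0 < p i) ->
  exists2 e, 0 < e & forall i, i \in s -> 0 < p i + e * q i.
Proof.
(* Asking for all smaller [e'] as well lets the induction take a minimum. *)
move=> p0; suff [e e0 h] : exists2 e, 0 < e &
    forall e', 0 < e' <= e -> forall i, i \in s -> 0 < p i + e' * q i.
  by exists e => // i; apply: h; rewrite e0 lexx.
elim: s p0 => [|i s ih] p0; first by exists 1.
have [|e e0 he] := ih _; first by move=> j js; rewrite p0// inE js orbT.
have pi0 : 0 < p i by rewrite p0// mem_head.
(* Up to [e1] the perturbation is at most half of [p i]; the 1 in the denominator avoids division by
   zero. *)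
pose e1 := p i / (2 * (1 + `|q i|)).
have q0 := normr_ge0 (q i).
have e10 : 0 < e1 by rewrite divr_gt0// mulr_gt0// ltr_pwDl.
exists (Num.min e e1); first by rewrite lt_min e0.
move=> e'; rewrite le_min => /and3P[e'0 e'e e'e1] j; rewrite inE => /predU1P[->|js].
  have : e' * (2 * (1 + `|q i|)) <= p i.
    by rewrite -ler_pdivlMr// mulr_gt0// ltr_pwDl.
  have : - (e' * `|q i|) <= e' * q i.
    by rewrite -mulrN ler_pM2l// lerNl -normrN ler_norm.
  nra.
by apply: he => //; rewrite e'0.
Qed.

(* Gordan's alternative.  When the new vector k is negative on the functional a found
   for s, the vectors of s are first pushed along k into the kernel of a. *)
Lemma cone_finite_positive (R : realType) n (K : set 'rV[R]_n) :
  (forall u v, K u -> K v -> K (u + v)) ->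
  (forall c u, 0 < c -> K u -> K (c *: u)) ->
  ~ K 0 ->
  forall s : seq 'rV[R]_n, (forall v, v \in s -> K v) ->
    exists a, forall v, v \in s -> 0 < dotp a v.
Proof.
(* Induction on the length: the hypothesis is also applied to the pushed list, which is not a tail
   of [s]. *)
move=> KD KZ K0 s; move: {2}(size s) (erefl (size s)) => m.
elim: m s => [|m ih] [|k s]//=; [by exists 0|move=> [sm] Ks].
have Kk : K k by apply: Ks; rewrite mem_head.
have k0 : 0 < dotp k k by rewrite dotpp_gt0; apply/eqP => k0; rewrite k0 in Kk.
have perturb b : (forall v, v \in s -> 0 < dotp b v) -> 0 <= dotp b k ->
    exists a, forall v, v \in k :: s -> 0 < dotp a v.
  move=> bs bk; have [e e0 he] := small_perturbation (dotp k) bs.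
  exists (b + e *: k) => v; rewrite dotpDl dotpZl inE => /predU1P[->|/he//].
  by rewrite ltr_wpDl// mulr_gt0.
have Ks' v : v \in s -> K v by move=> vs; apply: Ks; rewrite inE vs orbT.
have [a ha] := ih _ sm Ks'.
have [|ak] := leP 0 (dotp a k); first exact: perturb.
pose c v := - dotp a v / dotp a k.
have c0 v : v \in s -> 0 < c v.
  by move=> /ha av; rewrite /c mulNr -mulrN -invrN divr_gt0// oppr_gt0.
have [||b hb] := ih [seq v + c v *: k | v <- s]; first by rewrite size_map.
  by move=> _ /mapP[v vs ->]; apply: KD; [exact: Ks'|apply: KZ => //; exact: c0].
have ak0 : dotp a k != 0 by rewrite lt_eqF.
(* This functional vanishes on [k] and takes on each v of [s] the value of [b] on the pushed vector;
   [perturb] then makes it strictly positive on [k] too. *)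
apply: (perturb (b - (dotp b k / dotp a k) *: a)); last first.
  by rewrite dotpDl dotpNl dotpZl divfK// subrr.
move=> v vs; have /hb : v + c v *: k \in [seq v + c v *: k | v <- s].
  by apply/mapP; exists v.
suff -> : dotp (b - (dotp b k / dotp a k) *: a) v = dotp b (v + c v *: k) by [].
by rewrite dotpDl dotpNl dotpZl dotpDr dotpZr /c; field.
Qed.

Lemma compact_unit_sphere (R : realType) n :
  compact [set a : 'rV[R]_n | dotp a a = 1].
Proof.
have cbox : compact [set v : 'rV[R]_n | forall i, `[(-1 : R), 1]%classic (v ord0 i)].
  by apply: (@rV_compact R n (fun=> `[(-1 : R), 1]%classic)) => i; exact: segment_compact.
apply: subclosed_compact cbox _.
  apply: (@preimage_closed _ _ (fun a : 'rV[R]_n => dotp a a) [set 1]).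
    by move=> x _; exact: continuous_dotpp.
  exact: closed_eq.
move=> a /= a1 i; rewrite /= in_itv/= -ler_norml -(@ler_pXn2r _ 2) ?nnegrE// expr1n real_normK ?num_real//.
rewrite -a1 /dotp (bigD1 i)//= expr2 lerDl.
by apply: sumr_ge0 => j _; rewrite -expr2 sqr_ge0.
Qed.

(** Each v in K confines the functional to a closed subset of the unit sphere, and
    [cone_finite_positive] makes finitely many such subsets meet. Adding [k0] to the list forces the
    functional found there to be nonzero, so that it can be normalised. Strictness is lost in the
    passage to all of K. *)
Lemma cone_half_space (R : realType) n (K : set 'rV[R]_n) :
  (forall u v, K u -> K v -> K (u + v)) ->
  (forall c u, 0 < c -> K u -> K (c *: u)) ->
  ~ K 0 -> K !=set0 ->
  exists2 a, dotp a a = 1 & forall v, K v -> 0 <= dotp a v.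
Proof.
move=> KD KZ K0 [k0 Kk0].
have := @compact_unit_sphere R n; rewrite compact_In0 => /(_ _ K
  (fun v => [set a | dotp a a = 1] `&` [set a | 0 <= dotp a v])) [].
- exists (fun v => [set a | 0 <= dotp a v]) => // v _.
  apply: (@preimage_closed _ _ (fun a => dotp a v) [set x | 0 <= x]).
    by move=> x _; exact: continuous_dotpl.
  exact: closed_ge.
- move=> D' D'K; have [|a ha] := @cone_finite_positive _ _ K KD KZ K0 (k0 :: finmap.enum_fset D').
    by move=> v; rewrite inE => /predU1P[->//|/D'K]; rewrite inE.
  have a0 : 0 < dotp a a.
    rewrite dotpp_gt0; apply: contraTneq (ha k0 (mem_head _ _)) => ->.
    by rewrite /dotp big1 ?ltxx// => i _; rewrite mxE mul0r.
  have c0 : 0 < (Num.sqrt (dotp a a))^-1 by rewrite invr_gt0 sqrtr_gt0.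
  exists ((Num.sqrt (dotp a a))^-1 *: a) => v /= vD'; split.
    rewrite dotpZl dotpZr mulrA -invfM -expr2 sqr_sqrtr ?ltW// mulVf//.
    by rewrite gt_eqF.
  by rewrite dotpZl mulr_ge0 ?(ltW c0)// ltW// ha// inE vD' orbT.
- by move=> a ha; exists a => [|v Kv]; [have [] := ha _ Kk0|have [] := ha _ Kv].
Qed.

Section separation.
Context {R : realType} {d : nat}.
Implicit Types (x y : d.-tuple R) (A B : set (d.-tuple R)).

(** Homogeneous coordinates: [dotp a (lift1 x)] is the general affine function of x, so affine
    separation becomes linear. *)
Definition lift1 x : 'rV[R]_d.+1 := \row_i oapp (tnth x) 1 (unlift ord0 i).

Definition segt x y (t : R) := [tuple (1 - t) * tnth x i + t * tnth y i | i < d].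

Lemma lift1_segt x y t : lift1 (segt x y t) = (1 - t) *: lift1 x + t *: lift1 y.
Proof.
by apply/rowP => i; rewrite !mxE; case: unliftP => [j|] _ /=;
  rewrite ?tnth_mktuple// !mulr1 subrK.
Qed.

Lemma lift1_inj x y s s' : 0 <= s -> 0 <= s' -> 0 < s + s' ->
  s *: lift1 x = s' *: lift1 y -> x = y.
Proof.
move=> s0 s'0 ss /rowP E.
have ss' : s = s' by move: (E ord0); rewrite !mxE unlift_none /= !mulr1.
have sn0 : s != 0 by apply: contraTneq ss => s00; rewrite -ss' s00 addr0 ltxx.
apply: eq_from_tnth => i; move: (E (lift ord0 i)); rewrite !mxE liftK /= -ss'.
exact: mulfI.
Qed.

Lemma convex_cone_add A x y s t : convex_cell A -> A x -> A y -> 0 <= s -> 0 <= t ->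
  exists2 z, A z & s *: lift1 x + t *: lift1 y = (s + t) *: lift1 z.
Proof.
move=> cA Ax Ay s0 t0; have [st|st] := eqVneq (s + t) 0.
  exists x => //; move/eqP: st; rewrite paddr_eq0// => /andP[/eqP-> /eqP->].
  by rewrite addr0 !scale0r addr0.
exists (segt x y (t / (s + t))); last first.
  rewrite lift1_segt scalerDr !scalerA; congr (_ *: _ + _ *: _); field; exact: st.
apply: cA => //; rewrite divr_ge0 ?addr_ge0//= ler_pdivrMr ?mul1r ?lerDr//.
by rewrite lt_def st addr_ge0.
Qed.

Lemma disjoint_convex_separation A B : convex_cell A -> convex_cell B ->
  A `&` B = set0 ->
  exists2 a, dotp a a = 1 & (forall x, A x -> 0 <= dotp a (lift1 x)) /\
                            (forall x, B x -> dotp a (lift1 x) <= 0).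
Proof.
move=> cA cB AB0.
pose e : 'rV[R]_d.+1 := delta_mx 0 ord0.
have e0 x : dotp e (lift1 x) = 1.
  rewrite /dotp (bigD1 ord0)//= !mxE eqxx mul1r unlift_none/= big1 ?addr0// => i i0.
  by rewrite !mxE (negbTE i0) andbF mul0r.
have e00 : dotp e e = 1.
  rewrite /dotp (bigD1 ord0)//= !mxE !eqxx mul1r big1 ?addr0// => i i0.
  by rewrite !mxE (negbTE i0) andbF mul0r.
(* If one set is empty, a constant affine function separates; afterwards a point of each set is at
   hand. *)
have [A0|/set0P[a0 Aa0]] := eqVneq A set0.
  exists (- e); rewrite ?dotpNl ?dotpNr ?opprK//; split => x.
    by rewrite A0.
  by rewrite dotpNl e0 lerN10.
have [B0|/set0P[b0 Bb0]] := eqVneq B set0.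
  by exists e => //; split => x; rewrite ?B0// e0.
(* If 0 were in K, coordinate 0 would force s = t and the others a common point of A and B. The
   weights (1, 0) and (0, 1) later give the two inequalities. *)
pose K := [set v | exists x y s t, [/\ A x, B y, 0 <= s & 0 <= t] /\
  0 < s + t /\ v = s *: lift1 x - t *: lift1 y].
have [||||a a1 aK] := @cone_half_space _ _ K.
- move=> u v [x [y [s [t [[Ax By s0 t0] [st eu]]]]]].
  move=> [x' [y' [s' [t' [[Ax' By' s'0 t'0] [st' ev]]]]]]; rewrite {}eu {}ev.
  have [z Az zE] := convex_cone_add cA Ax Ax' s0 s'0.
  have [w Bw wE] := convex_cone_add cB By By' t0 t'0.
  exists z, w, (s + s'), (t + t'); split; first by split => //; rewrite addr_ge0.
  by rewrite addrACA addr_gt0// -zE -wE opprD addrACA.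
- move=> c v c0 [x [y [s [t [[Ax By s0 t0] [st ev]]]]]]; rewrite {}ev.
  exists x, y, (c * s), (c * t); split.
    by split; rewrite ?mulr_ge0 ?(ltW c0).
  by rewrite -mulrDr mulr_gt0// scalerBr !scalerA.
- move=> [x [y [s [t [[Ax By s0 t0] [st /eqP]]]]]].
  rewrite eq_sym subr_eq0 => /eqP /(lift1_inj s0 t0 st) xy.
  have : (A `&` B) x by split => //; rewrite xy.
  by rewrite AB0.
- exists (1 *: lift1 a0 - 0 *: lift1 b0), a0, b0, 1, 0; split; first by split.
  by rewrite addr0 ltr01.
exists a => //; split => x Xx.
  apply: aK; exists x, b0, 1, 0; split; first by split.
  by rewrite addr0 ltr01 scale0r subr0 scale1r.
rewrite -oppr_ge0 -dotpNr; apply: aK; exists a0, x, 0, 1; split; first by split.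
by rewrite add0r ltr01 scale0r sub0r scale1r.
Qed.

End separation.

(** * Subsequential limits of convex quantizers *)

Lemma cofinal_cvg (s : nat -> nat) : (forall k, (k <= s k)%N) -> s @ \oo --> \oo.
Proof.
move=> sk A [N _ NA]; exists N => // k /= Nk; apply: NA => /=.
exact: leq_trans Nk (sk k).
Qed.

(** Subsequences are encoded by [k <= s k]: this is enough for limits to pass and is stable under
    composition, which the induction over the finite index set uses. *)
Lemma bounded_family_subseq (R : realType) (I : finType) (u : nat -> I -> R) (B : R) :
  (forall n i, `|u n i| <= B) ->
  exists2 s : nat -> nat, (forall k, (k <= s k)%N) &
    exists l : I -> R, forall i, u (s k) i @[k --> \oo] --> l i.
Proof.
move=> uB; suff [s sk sl] : exists2 s : nat -> nat, (forall k, (k <= s k)%N) &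
    forall i, i \in enum I -> exists l : R, u (s k) i @[k --> \oo] --> l.
  exists s => //; suff /choice[l hl] : forall i, exists l : R, u (s k) i @[k --> \oo] --> l.
    by exists l.
  by move=> i; apply: sl; rewrite mem_enum.
elim: (enum I) => [|i r [s sk sl]]; first by exists id.
have [|s' s'inc /cvg_ex[l /= s'l]] := @bolzano_weierstrass R (fun k => u (s k) i).
  exists B; split; first exact: num_real.
  by move=> x Bx k _ /=; exact: le_trans (uB _ _) (ltW Bx).
have s'k k : (k <= s' k)%N.
  elim: k => // k ih; apply: leq_ltn_trans ih _.
  by move/increasing_seqP : s'inc => /(_ k).
exists (s \o s') => [k /=|j]; first exact: leq_trans (s'k k) (sk _).
rewrite inE => /predU1P[->|/sl[lj ulj]]; first by exists l.
by exists lj; exact: (cvg_comp _ _ (cofinal_cvg s'k) ulj).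
Qed.

Lemma near_finType_forall (I : finType) (P : I -> nat -> Prop) :
  (forall i, \forall k \near \oo, P i k) -> \forall k \near \oo, forall i, P i k.
Proof.
move=> h; suff : \forall k \near \oo, forall i, i \in enum I -> P i k.
  by apply: filterS => k hk i; apply: hk; rewrite mem_enum.
elim: (enum I) => [|i r ih]; first by near=> k.
near=> k => j; rewrite inE => /predU1P[->|]; first by near: k; exact: h.
by move: j; near: k.
Unshelve. all: by end_near. Qed.

Section quantizer_limit.
Context {R : realType} {d M : nat}.
Local Notation X := (d.-tuple R).

(** Homogeneous coordinates of a direction: [dotp a (lift0 v)] is the derivative along v of the
    affine function given by a. *)
Definition lift0 (v : X) : 'rV[R]_d.+1 := \row_i oapp (tnth v) 0 (unlift ord0 i).

Definition shift (x : X) (e : R) (v : X) : X := [tuple tnth x i + e * tnth v i | i < d].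

Lemma lift1_shift x e v : lift1 (shift x e v) = lift1 x + e *: lift0 v.
Proof.
by apply/rowP => i; rewrite !mxE; case: unliftP => [j|] _ /=;
  rewrite ?tnth_mktuple// mulr0 addr0.
Qed.

Lemma dotp_lift1 (a : 'rV[R]_d.+1) (x : X) :
  dotp a (lift1 x) = a 0 ord0 + \sum_(i < d) a 0 (lift ord0 i) * tnth x i.
Proof.
rewrite /dotp big_ord_recl !mxE unlift_none /= mulr1; congr (_ + _).
by apply: eq_bigr => i _; rewrite !mxE liftK.
Qed.

Lemma dotp_lift0 (a : 'rV[R]_d.+1) (v : X) :
  dotp a (lift0 v) = \sum_(i < d) a 0 (lift ord0 i) * tnth v i.
Proof.
rewrite /dotp big_ord_recl !mxE unlift_none /= mulr0 add0r.
by apply: eq_bigr => i _; rewrite !mxE liftK.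
Qed.

(* v has coordinates 1, t, t^2, ... where t avoids the roots of finitely many polynomials. *)
Lemma generic_direction (I : finType) (a : I -> 'rV[R]_d.+1) :
  exists v : X, forall i,
    (exists k, a i 0 (lift ord0 k) != 0) -> dotp (a i) (lift0 v) != 0.
Proof.
pose r i : 'rV[R]_d := \row_k a i 0 (lift ord0 k).
pose P i := rVpoly (r i).
pose Q := \prod_(i | P i != 0) P i.
have Q0 : Q != 0 by apply/prodf_neq0.
have [t Qt] : exists t, ~~ root Q t.
  apply: contrapT => /forallNP h.
  have := @max_poly_roots _ Q [seq n%:R | n <- iota 0 (size Q)] Q0.
  rewrite size_map size_iota ltnn => H; suff: false by []; apply: H.
    by apply/allP => x _; apply: contrapT => /negP /h.
  by rewrite map_inj_uniq ?iota_uniq//; exact/mulrIn/oner_neq0.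
exists [tuple t ^+ i | i < d] => i [k ak].
have Pi0 : P i != 0.
  apply: contraNneq ak => Pi0; have := rVpolyK (r i).
  by rewrite -/(P i) Pi0 linear0 => /rowP/(_ k); rewrite !mxE => <-.
have : (P i).[t] != 0.
  apply: contraNneq Qt => Pt; rewrite /root horner_prod.
  by rewrite (bigD1 i)//= Pt mul0r.
suff -> : (P i).[t] = dotp (a i) (lift0 [tuple t ^+ i | i < d]) by [].
rewrite dotp_lift0 /P /rVpoly horner_poly; apply: eq_bigr => j _.
by rewrite valK mxE tnth_mktuple.
Qed.

(** The points from which an arbitrarily small step along v makes the affine function positive; a
    boundary point belongs when v points inwards. *)
Definition half_space (a : 'rV[R]_d.+1) (v : X) : set X := [set x |
  if 0 < dotp a (lift0 v) then 0 <= dotp a (lift1 x) else 0 < dotp a (lift1 x)].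

Lemma convex_half_space a v : convex_cell (half_space a v).
Proof.
move=> x y t; rewrite /half_space/= -/(segt x y t) lift1_segt dotpDr !dotpZr.
by case: ifP => _ h1 h2 /andP[t0 t1]; nra.
Qed.

Lemma convexC_half_space a v : convex_cell (~` half_space a v).
Proof.
move=> x y t; rewrite /half_space/= -/(segt x y t) lift1_segt dotpDr !dotpZr.
by case: ifP => _ /negP + /negP + /andP[t0 t1]; rewrite -?leNgt -?ltNge => h1 h2;
  apply/negP; rewrite -?leNgt -?ltNge; nra.
Qed.

Lemma measurable_dotp_lift1 a : measurable_fun [set: X] (fun x => dotp a (lift1 x)).
Proof.
under eq_fun do rewrite dotp_lift1.
apply: measurable_funD => //; apply: measurable_sum => i.
apply: measurable_funM => //; exact: measurable_tnth.
Qed.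

Lemma measurable_half_space a v : measurable (half_space a v).
Proof.
have hm (D : set R) : measurable D ->
    measurable ((fun x => dotp a (lift1 x)) @^-1` D).
  by move=> mD; rewrite -[X in measurable X]setTI; exact: measurable_dotp_lift1.
have [v0|v0] := boolP (0 < dotp a (lift0 v)).
  suff -> : half_space a v = (fun x => dotp a (lift1 x)) @^-1` `[0, +oo[ by exact: hm.
  by apply/seteqP; split => x; rewrite /half_space/= v0 in_itv/= andbT.
suff -> : half_space a v = (fun x => dotp a (lift1 x)) @^-1` `]0, +oo[ by exact: hm.
by apply/seteqP; split => x; rewrite /half_space/= (negbTE v0) in_itv/= andbT.
Qed.

(* Limiting separating hyperplanes determine the limit quantizer off their union;
   on the union ties are broken by moving infinitesimally in a direction v
   transversal to all of them, which keeps the cells polyhedral. *)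
Lemma convex_quantizer_compact (Q_ : nat -> X -> 'I_M) : (forall n, inQc (Q_ n)) ->
  exists2 Q : X -> 'I_M, inQc Q &
  exists2 s : nat -> nat, (forall k, (k <= s k)%N) &
  exists2 A : 'I_M -> 'I_M -> 'rV[R]_d.+1, (forall i j, dotp (A i j) (A i j) = 1) &
  forall x, (forall i j, dotp (A i j) (lift1 x) != 0) ->
    \forall k \near \oo, Q_ (s k) x = Q x.
Proof.
move=> Qc.
have /choice[al hal] : forall nij : nat * ('I_M * 'I_M), exists a : 'rV[R]_d.+1,
    dotp a a = 1 /\ (nij.2.1 != nij.2.2 ->
     (forall x, Q_ nij.1 x = nij.2.1 -> 0 <= dotp a (lift1 x)) /\
     (forall x, Q_ nij.1 x = nij.2.2 -> dotp a (lift1 x) <= 0)).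
  move=> [n [i j]] /=; have [ij|ij] := eqVneq i j.
    (* On the diagonal any unit vector will do; separating two empty sets supplies one. *)
    have [|||a a1 _] := @disjoint_convex_separation R d set0 set0.
    - by [].
    - by [].
    - by rewrite setI0.
    by exists a.
  have [_ ci] := Qc n i; have [_ cj] := Qc n j.
  have [|a a1 aij] := disjoint_convex_separation ci cj.
    apply/seteqP; split => x //= [/= Qi Qj].
    by move: ij; rewrite -Qi -Qj eqxx.
  by exists a; split.
have alB n p : `|al (n, p.1) 0 p.2| <= 1.
  have [a1 _] := hal (n, p.1).
  rewrite -(@ler_pXn2r _ 2) ?nnegrE// expr1n real_normK ?num_real//.
  rewrite -a1 /dotp (bigD1 p.2)//= expr2 lerDl.
  by apply: sumr_ge0 => j _; rewrite -expr2 sqr_ge0.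
have [s sk [l sl]] := bounded_family_subseq
  (u := fun n (p : ('I_M * 'I_M) * 'I_d.+1) => al (n, p.1) 0 p.2) alB.
pose A (i j : 'I_M) : 'rV[R]_d.+1 := \row_k l ((i, j), k).
have Acvg i j w : dotp (al (s k, (i, j))) w @[k --> \oo] --> dotp (A i j) w.
  apply: (@cvg_big _ _ +%R) => [|k _]; first exact: add_continuous.
  by apply: cvgM; [rewrite mxE; exact: (sl ((i, j), k))|exact: cvg_cst].
have A1 i j : dotp (A i j) (A i j) = 1.
  have : dotp (al (s k, (i, j))) (al (s k, (i, j))) @[k --> \oo] --> dotp (A i j) (A i j).
    apply: (@cvg_big _ _ +%R) => [|k _]; first exact: add_continuous.
    by apply: cvgM; rewrite mxE; exact: (sl ((i, j), k)).
  rewrite (_ : (fun k => _) = cst 1); last first.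
    by apply/funext => k /=; have [] := hal (s k, (i, j)).
  by move=> /(cvg_lim (@Rhausdorff R)); rewrite lim_cst.
have [v hv] := generic_direction (fun ij : 'I_M * 'I_M => A ij.1 ij.2).
(* A unit vector with zero linear part is a nonzero constant and vanishes nowhere. So a limit
   hyperplane through [x] has a linear part, and [v] is transversal to it. *)
have transversal i j x : dotp (A i j) (lift1 x) = 0 -> dotp (A i j) (lift0 v) != 0.
  move=> Ax; apply: (hv (i, j)) => /=; apply: contrapT => /forallNP A0.
  have {}A0 k : A i j 0 (lift ord0 k) = 0.
    by apply/eqP; apply: contrapT => /negP /A0.
  have := A1 i j; move: Ax; rewrite dotp_lift1 /dotp big_ord_recl !big1 ?addr0.
  - by move=> -> /eqP; rewrite mul0r eq_sym oner_eq0.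
  - by move=> k _; rewrite A0 mul0r.
  - by move=> k _; rewrite A0 mul0r.
(* [A i j] and [A j i] come from separate choices, so both directions of a comparison use the
   functional with the smaller index first; this makes [beats] antisymmetric. *)
pose beats (i j : 'I_M) : set X := if (i < j)%N then half_space (A i j) v else ~` half_space (A j i) v.
have beatsC i j x : i != j -> beats i j x -> ~ beats j i x.
  rewrite /beats -val_eqE neq_ltn => /orP[] ij; rewrite ij.
    by rewrite (ltnNge j) (ltnW ij)/= => h; apply.
  by rewrite (ltnNge i) (ltnW ij)/=.
pose wins i x := forall j, i != j -> beats i j x.
have wins_unique i j x : wins i x -> wins j x -> i = j.
  move=> wi wj; apply/eqP; apply: contrapT => /negP ij.
  by apply: (beatsC i j x ij); [exact: wi|apply: wj; rewrite eq_sym].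
(* At such [y] the approximating functionals eventually have the strict signs of their limits, and
   the cell that [Q_ (s k)] gives to [y] is on the weak side of each of its separators. *)
have generic_wins y : (forall i j : 'I_M, (i < j)%N -> dotp (A i j) (lift1 y) != 0) ->
    \forall k \near \oo, wins (Q_ (s k) y) y.
  move=> yA.
  have : \forall k \near \oo, forall ij : 'I_M * 'I_M, (ij.1 < ij.2)%N ->
      (0 < dotp (A ij.1 ij.2) (lift1 y) -> 0 < dotp (al (s k, ij)) (lift1 y)) /\
      (dotp (A ij.1 ij.2) (lift1 y) < 0 -> dotp (al (s k, ij)) (lift1 y) < 0).
    apply: near_finType_forall => -[i j] /=.
    have [ij|ij] := boolP (i < j)%N; last by near=> k.
    have := yA i j ij; rewrite neq_lt => /orP[] Ay; near=> k => _; split => //.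
    - by move=> /(lt_trans Ay); rewrite ltxx.
    - by move=> _; near: k; exact: (cvgr_lt _ (Acvg i j (lift1 y)) _ Ay).
    - by move=> _; near: k; exact: (cvgr_gt _ (Acvg i j (lift1 y)) _ Ay).
    - by move=> /(lt_trans Ay); rewrite ltxx.
  apply: filterS => k hk j.
  set i := Q_ (s k) y; rewrite /beats => nij; case: ifPn => ij.
    have [_ /(_ nij)[/(_ y erefl) aly _]] := hal (s k, (i, j)).
    have [_ Aneg] := hk (i, j) ij.
    have Apos : 0 < dotp (A i j) (lift1 y).
      have := yA i j ij; rewrite neq_lt => /orP[/Aneg|//].
      by rewrite ltNge aly.
    by rewrite /half_space/=; case: ifP => // _; exact: ltW.
  have ji : (j < i)%N by rewrite ltn_neqAle leqNgt ij andbT eq_sym.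
  have nji : j != i by rewrite eq_sym.
  have [_ /(_ nji)[_ /(_ y erefl) aly]] := hal (s k, (j, i)).
  have [Apos _] := hk (j, i) ji.
  have Aneg : dotp (A j i) (lift1 y) < 0.
    have := yA j i ji; rewrite neq_lt => /orP[//|/Apos].
    by rewrite ltNge aly.
  rewrite /half_space/=; case: ifP => _; apply/negP; rewrite -?ltNge -?leNgt//.
  exact: ltW.
(* Every point has the same comparisons as some generic point, so a winner also exists on the
   hyperplanes themselves. *)
have perturb x : exists y, (forall i j : 'I_M, (i < j)%N -> dotp (A i j) (lift1 y) != 0) /\
    forall i j, beats i j y <-> beats i j x.
  pose g ij := dotp (A ij.1 ij.2) (lift1 x).
  pose h ij := dotp (A ij.1 ij.2) (lift0 v).
  (* Positivity of |g| + e sg(g) h says that g + e h keeps the sign of g; where g = 0 the dummy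
     value 1 makes the condition void. *)
  have [|e e0 he] := @small_perturbation R _ (enum {: 'I_M * 'I_M})
      (fun ij => if g ij == 0 then 1 else `|g ij|)
      (fun ij => if g ij == 0 then 0 else Num.sg (g ij) * h ij).
    by move=> ij _; case: eqP => [_|/eqP]; rewrite ?ltr01// normr_gt0.
  have gy i j : dotp (A i j) (lift1 (shift x e v)) = g (i, j) + e * h (i, j).
    by rewrite lift1_shift dotpDr dotpZr.
  have signs i j : (g (i, j) = 0 /\ h (i, j) != 0) \/
      (0 < g (i, j) /\ 0 < g (i, j) + e * h (i, j)) \/
      (g (i, j) < 0 /\ g (i, j) + e * h (i, j) < 0).
    have := he (i, j); rewrite mem_enum => /(_ isT).
    have [g0|g0|g0 _] := ltgtP (g (i, j)) 0.
    - by rewrite ltr0_norm// ltr0_sg// => ?; right; right; split => //; nra.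
    - by rewrite gtr0_norm// gtr0_sg// mul1r => ?; right; left.
    - by left; split => //; exact: (transversal i j x g0).
  have half_space_shift i j :
      half_space (A i j) v (shift x e v) <-> half_space (A i j) v x.
    rewrite /half_space/= gy -/(g (i, j)) -/(h (i, j)).
    case: (signs i j) => [[-> h0]|[[g0 g1]|[g0 g1]]].
    - rewrite add0r pmulr_rge0// pmulr_rgt0// lexx ltxx.
      by case h1: (0 < h _); split => // _; exact: ltW.
    - by case: ifP => _; split; lra.
    - by case: ifP => _; split; lra.
  exists (shift x e v); split => [i j _|i j].
    rewrite gy; case: (signs i j) => [[-> h0]|[[_ /gt_eqF->//]|[_ /lt_eqF->//]]].
    by rewrite add0r mulf_neq0// gt_eqF.
  by rewrite /beats; case: ifP => _ /=; rewrite half_space_shift.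
have /choice[Q Qwins] : forall x, exists i, wins i x.
  move=> x; have [y [yA yx]] := perturb x.
  have [N _ /(_ N (leqnn N)) wN] := generic_wins y yA.
  by exists (Q_ (s N) y) => j /wN /yx.
have cellQ i : cell Q i = wins i.
  apply/seteqP; split => x /=; first by move=> <-; exact: Qwins.
  by move=> wi; exact: wins_unique (Qwins x) wi.
exists Q => [i|]; last first.
  exists s => //; exists A => // x xA.
  have := generic_wins x (fun i j _ => xA i j).
  by apply: filterS => k wk; exact: wins_unique wk (Qwins x).
rewrite cellQ; split.
  rewrite (_ : wins i = \bigcap_(j in [set j | i != j]) beats i j)//.
  apply: fin_bigcap_measurable => [|j _]; first exact: finite_finset.
  rewrite /beats.
  by case: ifP => _; [|apply: measurableC]; exact: measurable_half_space.
move=> x y t wx wy t01 j ij; move: (wx j ij) (wy j ij); rewrite /beats.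
by case: ifP => _ hx hy; [exact: convex_half_space|exact: convexC_half_space].
Unshelve. all: by end_near. Qed.

End quantizer_limit.

(** * Hyperplanes are Lebesgue-null *)

Lemma measure_bigsetU_le d (T : measurableType d) (R : realType)
    (mu : {measure set T -> \bar R}) (I : Type) (s : seq I) (F : I -> set T) :
  (forall i, measurable (F i)) ->
  (mu (\big[setU/set0]_(i <- s) F i) <= \sum_(i <- s) mu (F i))%E.
Proof.
move=> mF; elim: s => [|i s ih]; first by rewrite !big_nil measure0.
rewrite !big_cons; apply: le_trans (measureU2 _ (mF i) _) _.
  exact: bigsetU_measurable.
exact: leeD2l.
Qed.

Lemma interval_pigeonhole (R : realType) (m : nat) (lo w t : R) : (0 < m)%N ->
  lo <= t <= lo + m%:R * w ->
  exists k : 'I_m, lo + k%:R * w <= t <= lo + k%:R * w + w.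
Proof.
move=> + /andP[lot]; elim: m => // m ih _.
have [->|m0] := posnP m.
  by rewrite mul1r => tw; exists ord0; rewrite mul0r addr0 lot.
have [tm _|tm] := leP t (lo + m%:R * w).
  by have [k hk] := ih m0 tm; exists (widen_ord (leqnSn m) k).
by rewrite -natr1 mulrDl mul1r addrA => tw; exists ord_max; rewrite (ltW tm).
Qed.

Section lebesgue.
Context {R : realType} {d : nat}.
Local Notation X := (d.-tuple R).

Lemma measurable_box (a b : X) : measurable (box a b).
Proof.
rewrite (_ : box a b = \bigcap_(i in [set: 'I_d]) ((fun x : X => tnth x i) @^-1` `[tnth a i, tnth b i])).
  apply: fin_bigcap_measurable => [|i _]; first exact: finite_finset.
  by rewrite -[X in measurable X]setTI; exact: measurable_tnth.
by apply/seteqP; split => x /= h i; [move=> _ /=; rewrite in_itv/=|have := h i I; rewrite /= in_itv/=].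
Qed.

Definition origin : X := [tuple 0 | _ < d].

Definition cube (x : X) (r : R) : set X :=
  box [tuple tnth x i - r | i < d] [tuple tnth x i + r | i < d].

Lemma cubeP x r y : cube x r y <-> forall i, `|tnth x i - tnth y i| <= r.
Proof.
split=> h i; have := h i; rewrite ?tnth_mktuple.
  by rewrite ler_norml => /andP[h1 h2]; lra.
by rewrite ler_norml => /andP[h1 h2]; apply/andP; split; lra.
Qed.

Lemma measurable_cube x r : measurable (cube x r).
Proof. exact: measurable_box. Qed.

Lemma lebesgue_cube (lam : {measure set X -> \bar R}) x r : is_lebesgue lam -> 0 <= r ->
  lam (cube x r) = ((2 * r) ^+ d)%:E.
Proof.
move=> hlam r0; rewrite hlam; last by move=> i; rewrite !tnth_mktuple; lra.
congr (_%:E); rewrite -[in RHS](card_ord d) -prodr_const; apply: eq_bigr => i _.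
by rewrite !tnth_mktuple; ring.
Qed.

Lemma bigcup_cube x : \bigcup_n cube x n%:R = [set: X].
Proof.
apply/seteqP; split => // y _.
exists (Num.truncn (\sum_i `|tnth x i - tnth y i|)).+1 => //; apply/cubeP => i.
apply: le_trans (ltW (truncnS_gt _)).
by rewrite (bigD1 i)//= lerDl sumr_ge0.
Qed.

Lemma lebesgue_sigma_finite (lam : {measure set X -> \bar R}) : is_lebesgue lam -> sigma_finite [set: X] lam.
Proof.
move=> hlam; exists (fun n => cube origin n%:R).
  by rewrite bigcup_cube.
move=> n; split; first exact: measurable_cube.
by rewrite lebesgue_cube// ltry.
Qed.

Section hyperplane.
Variables (lam : {measure set X -> \bar R}) (hlam : is_lebesgue lam).
Variables (c0 : R) (c : 'I_d -> R) (j : 'I_d) (cj : c j != 0).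

Let H : set X := [set x | c0 + \sum_i c i * tnth x i = 0].
(** H is the graph of coordinate j over the other coordinates; this is its Lipschitz constant for
    the sup norm. *)
Let slope := (\sum_(i < d | i != j) `|c i|) / `|c j|.

Lemma measurable_hyperplane : measurable H.
Proof.
have : measurable_fun [set: X] (fun x : X => c0 + \sum_i c i * tnth x i).
  apply: measurable_funD => //; apply: measurable_sum => i.
  apply: measurable_funM => //; exact: measurable_tnth.
move=> /(_ measurableT [set 0] (measurable_set1 0)); rewrite setTI.
by congr measurable; apply/seteqP; split.
Qed.

(* H is covered inside a cube by graph pieces over a grid of mesh [2 L / m] in the
   coordinates other than j, each piece cut into m thin slices. *)
Lemma hyperplane_cube_le (L m : nat) : (0 < m)%N ->
  (lam (H `&` cube origin L%:R) <= ((2 * L%:R) ^+ d * (2 * slope) / m%:R)%R%:E)%E.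
Proof.
move=> m0; have mR0 : (m%:R : R) != 0 by rewrite pnatr_eq0 -lt0n.
have slope0 : 0 <= slope by rewrite divr_ge0// sumr_ge0.
pose e : R := 2 * L%:R / m%:R.
have e0 : 0 <= e by rewrite divr_ge0// mulr_ge0.
pose w : R := 2 * slope * e / m%:R.
have w0 : 0 <= w by rewrite divr_ge0// mulr_ge0// mulr_ge0.
(* Height of the graph over the lower corner of grid cell [k]. It ignores [k j], so that index is
   free to number the slices. *)
pose h (k : 'I_d -> 'I_m) : R :=
  - (c0 + \sum_(i < d | i != j) c i * (- L%:R + (k i)%:R * e)) / c j.
pose lo (k : {ffun 'I_d -> 'I_m}) : X := [tuple if i == j then h k - slope * e + (k j)%:R * w
                                   else - L%:R + (k i)%:R * e | i < d].
pose hi (k : {ffun 'I_d -> 'I_m}) : X := [tuple tnth (lo k) i + (if i == j then w else e) | i < d].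
pose F k := box (lo k) (hi k).
have cover : H `&` cube origin L%:R `<=` \big[setU/set0]_(k : {ffun 'I_d -> 'I_m}) F k.
  move=> x [Hx /cubeP xL].
  have xL' i : - L%:R <= tnth x i <= L%:R.
    by have := xL i; rewrite /origin tnth_mktuple sub0r normrN ler_norml.
  have /choice[k hk] : forall i, exists k : 'I_m,
      - L%:R + k%:R * e <= tnth x i <= - L%:R + k%:R * e + e.
    move=> i; apply: interval_pigeonhole => //.
    have -> : m%:R * e = 2 * L%:R by rewrite /e mulrC divfK.
    by have /andP[h1 h2] := xL' i; apply/andP; split; lra.
  have xj : tnth x j - h k =
      - (\sum_(i < d | i != j) c i * (tnth x i - (- L%:R + (k i)%:R * e))) / c j.
    have : c0 + (c j * tnth x j + \sum_(i < d | i != j) c i * tnth x i) = 0.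
      by move: Hx; rewrite /H/= (bigD1 j).
    set S1 := \sum_(i < d | _) c i * tnth x i => E.
    pose S2 := \sum_(i < d | i != j) c i * (- L%:R + (k i)%:R * e).
    have -> : \sum_(i < d | i != j) c i * (tnth x i - (- L%:R + (k i)%:R * e)) = S1 - S2.
      by rewrite -sumrB; apply: eq_bigr => i _; rewrite mulrBr.
    rewrite /h -/S2; have -> : S1 = - c0 - c j * tnth x j by lra.
    by field.
  have xjle : `|tnth x j - h k| <= slope * e.
    rewrite xj mulNr normrN normrM normfV /slope mulrAC ler_wpM2r// big_distrl/=.
    apply: le_trans (ler_norm_sum _ _ _) _; apply: ler_sum => i _.
    by rewrite normrM ler_wpM2l// ler_norml; have /andP[h1 h2] := hk i; lra.
  have [kj hkj] : exists kj : 'I_m, h k - slope * e + kj%:R * w <= tnth x j <=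
      h k - slope * e + kj%:R * w + w.
    apply: interval_pigeonhole => //.
    have -> : m%:R * w = 2 * (slope * e) by rewrite /w mulrC divfK// mulrA.
    by move: xjle; rewrite ler_norml => /andP[h1 h2]; lra.
  pose k' : {ffun 'I_d -> 'I_m} := [ffun i => if i == j then kj else k i].
  have hk' : h k' = h k.
    rewrite /h; congr (- (_ + _) / _); apply: eq_bigr => i ij.
    by rewrite ffunE (negbTE ij).
  rewrite -bigcup_seq; exists k'; first by rewrite /= mem_index_enum.
  move=> i; rewrite /hi /lo !tnth_mktuple hk' !ffunE eqxx.
  by case: eqP => [->|_].
have volF k : lam (F k) = (w * e ^+ d.-1)%:E.
  rewrite hlam; last first.
    by move=> i; rewrite [tnth (hi k) i]tnth_mktuple lerDl; case: ifP.
  congr (_%:E); rewrite (bigD1 j)//= [tnth (hi k) j]tnth_mktuple eqxx addrAC subrr add0r.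
  congr (_ * _); rewrite (eq_bigr (fun=> e)); last first.
    by move=> i ij; rewrite [tnth (hi k) i]tnth_mktuple (negbTE ij) addrAC subrr add0r.
  rewrite prodr_const; congr (_ ^+ _).
  by rewrite (cardC1 j) card_ord.
have mF k : measurable (F k) by exact: measurable_box.
apply: (@le_trans _ _ (lam (\big[setU/set0]_(k : {ffun 'I_d -> 'I_m}) F k))).
  apply: le_measure => //; rewrite inE.
    by apply: measurableI; [exact: measurable_hyperplane|exact: measurable_cube].
  by apply: bigsetU_measurable.
apply: le_trans (measure_bigsetU_le _ _ mF) _.
(* There are m^d boxes of volume w e^(d-1), and m e = 2 L; the slice thickness [w] supplies the
   surviving factor 1/m. *)
under eq_bigr do rewrite volF.
rewrite sumEFin lee_fin sumr_const card_ffun !card_ord -[leLHS]mulr_natl natrX.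
have d0 : d = d.-1.+1 by rewrite prednK// (leq_ltn_trans (leq0n j)).
have -> : 2 * L%:R = m%:R * e by rewrite /e [RHS]mulrC divfK.
have e_d : e ^+ d = e * e ^+ d.-1 by rewrite [in LHS]d0 exprS.
rewrite [(m%:R * e) ^+ d]exprMn e_d le_eqVlt; apply/orP; left; apply/eqP.
rewrite /w; field; exact: mR0.
Qed.

Lemma hyperplane_null : lam.-negligible H.
Proof.
have -> : H = \bigcup_L (H `&` cube origin L%:R).
  by rewrite -setI_bigcupr bigcup_cube setIT.
apply: negligible_bigcup => L.
have mHL : measurable (H `&` cube origin L%:R).
  by apply: measurableI; [exact: measurable_hyperplane|exact: measurable_cube].
apply/(negligibleP _ mHL)/eqP; rewrite -measure_le0; apply/lee_addgt0Pr => e e0.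
rewrite add0e; pose K := (2 * L%:R) ^+ d * (2 * slope).
have K0 : 0 <= K by rewrite !mulr_ge0 ?exprn_ge0 ?mulr_ge0 ?divr_ge0 ?sumr_ge0.
apply: le_trans (@hyperplane_cube_le L (Num.truncn (K / e)).+1 _) _ => //.
rewrite lee_fin ler_pdivrMr// -ler_pdivrMl// mulrC.
exact: ltW (truncnS_gt _).
Qed.

End hyperplane.

(** A hyperplane at infinity is harmless: with zero linear part, unit length makes the constant term
    nonzero and the set empty. *)
Lemma lift1_hyperplane_null (lam : {measure set X -> \bar R}) (a : 'rV[R]_d.+1) :
  is_lebesgue lam -> dotp a a = 1 ->
  lam.-negligible [set x | dotp a (lift1 x) = 0].
Proof.
move=> hlam a1; have [[j aj]|a0] := pselect (exists j, a 0 (lift ord0 j) != 0).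
  have := @hyperplane_null _ hlam (a 0 ord0) (fun k => a 0 (lift ord0 k)) j aj.
  by under eq_set do rewrite -dotp_lift1.
have {}a0 k : a 0 (lift ord0 k) = 0.
  by apply/eqP; apply: contrapT => /negP ak; apply: a0; exists k.
rewrite [X in _.-negligible X](_ : _ = set0); first exact: negligible_set0.
apply/seteqP; split => // x /=; rewrite dotp_lift1 big1 ?addr0 => [|k _]; last first.
  by rewrite a0 mul0r.
move=> a00; move: a1; rewrite /dotp big_ord_recl big1 ?addr0 => [|k _]; last first.
  by rewrite a0 mul0r.
by rewrite a00 mul0r => /eqP; rewrite eq_sym oner_eq0.
Qed.

End lebesgue.

(** * Joint measurability of the transition density *)

Section measurability.
Context {R : realType} {d : nat}.
Local Notation X := (d.-tuple R).

Lemma eucl_ge0 (x y : X) : 0 <= eucl x y.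
Proof. exact: sqrtr_ge0. Qed.

Lemma eucl_cube_le (x y : X) (r : R) : 0 <= r -> cube x r y -> eucl x y <= d%:R * r.
Proof.
move=> r0 /cubeP xy; rewrite -(@ler_pXn2r _ 2) ?nnegrE ?eucl_ge0 ?mulr_ge0//.
rewrite sqr_sqrtr; last by apply: sumr_ge0 => i _; exact: sqr_ge0.
apply: (@le_trans _ _ (\sum_(i < d) r ^+ 2)).
  apply: ler_sum => i _; rewrite -[leLHS]real_normK ?num_real//.
  by rewrite ler_pXn2r ?nnegrE.
rewrite sumr_const card_ord -[leLHS]mulr_natl exprMn ler_wpM2r ?sqr_ge0// -natrX ler_nat.
by case: (d) => // n; rewrite leq_pmulr.
Qed.

Definition eucl_continuous (g : X -> R) := forall x e, 0 < e ->
  exists2 del : R, 0 < del & forall y, eucl x y < del -> `|g y - g x| < e.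

Lemma lipschitz_eucl_continuous g L : lipschitz_eucl g L -> eucl_continuous g.
Proof.
move=> gL x e e0; have L0 : 0 < `|L| + 1 by rewrite ltr_wpDl.
exists (e / (`|L| + 1)); first by rewrite divr_gt0.
move=> y; rewrite ltr_pdivlMr// => xy; rewrite distrC.
apply: le_lt_trans (gL x y) _; apply: le_lt_trans xy.
rewrite mulrC ler_wpM2l ?eucl_ge0// (le_trans (ler_norm _))// lerDl//.
Qed.

(** A strict upper level set is the union of the countably many cubes with rational centre and
    radius 1/(n+1) that it contains. *)
Lemma eucl_continuous_measurable g : eucl_continuous g -> measurable_fun [set: X] g.
Proof.
move=> gc; apply: (measurability _ (RGenOInfty.measurableE R)) => _ [_ [r ->] <-].
rewrite setTI.
pose ctr (p : d.-tuple rat * nat) : X := [tuple ratr (tnth p.1 i) | i < d].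
pose B p := cube (ctr p) p.2.+1%:R^-1.
rewrite (_ : g @^-1` _ =
  \bigcup_(p in [set p | B p `<=` g @^-1` `]r, +oo[]) B p); last first.
  apply/seteqP; split => [x /=|x [p /= Bp] /Bp//].
  rewrite in_itv/= andbT => rgx.
  have [del del0 hdel] : exists2 del : R, 0 < del &
      forall y, eucl x y < del -> `|g y - g x| < g x - r.
    by apply: gc; rewrite subr_gt0.
  pose n := Num.truncn ((d%:R * 2) / del).
  have n0 : 0 < n.+1%:R^-1 :> R by rewrite invr_gt0.
  have /choice[q hq] : forall i, exists q : rat, `|ratr q - tnth x i| <= n.+1%:R^-1.
    move=> i; have [|q] := @rat_in_itvoo R (tnth x i) (tnth x i + n.+1%:R^-1).
      by rewrite ltrDl.
    rewrite in_itv/= => /andP[q1 q2]; exists q.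
    rewrite ger0_norm ?subr_ge0 ?(ltW q1)// lerBlDl; exact: ltW.
  exists ([tuple q i | i < d], n) => /=; last first.
    by apply/cubeP => i; rewrite !tnth_mktuple.
  move=> y /cubeP By /=; rewrite in_itv/= andbT.
  have /hdel : eucl x y < del.
    have r0 : 0 <= 2 * (n.+1%:R^-1 : R) by rewrite mulr_ge0// ltW.
    apply: (@le_lt_trans _ _ (d%:R * (2 * n.+1%:R^-1))).
      apply: eucl_cube_le => //; apply/cubeP => i.
      apply: le_trans (ler_distD (ratr (q i)) _ _) _.
      rewrite mulr_natl mulr2n lerD//; first by rewrite distrC.
      by have := By i; rewrite !tnth_mktuple.
    rewrite mulrA ltr_pdivrMr// [ltRHS]mulrC -ltr_pdivrMr//.
    exact: truncnS_gt.
  by rewrite ltr_norml => /andP[h1 h2]; lra.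
rewrite bigcup_mkcond; apply: countable_bigcupT_measurable; first exact: countableP.
by move=> p; case: ifP => // _; exact: measurable_cube.
Qed.

Variables (lam : {measure set X -> \bar R}) (W : probability X R) (f : X -> X -> X).
Variables (phi : X -> X -> R) (C1 : R).
Hypothesis hlam : is_lebesgue lam.
Hypothesis mf : measurable_fun [set: X * X] (fun p => f p.1 p.2).
Hypothesis fphi : forall x A, measurable A ->
  W (f x @^-1` A) = (\int[lam]_(z in A) (phi x z)%:E)%E.
Hypothesis phi_gt0 : forall x z, 0 < phi x z.
Hypothesis phi_lip : forall x, lipschitz_eucl (phi x) C1.

Lemma measurable_density x : measurable_fun [set: X] (phi x).
Proof. exact: (eucl_continuous_measurable (lipschitz_eucl_continuous (phi_lip x))). Qed.

(** The quotient is the mean of [phi x] over the cube, where [phi x] oscillates by at most the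
    right-hand side. It is written through [W] and [f], whose dependence on x is measurable. *)
Lemma density_average x z r : 0 < r ->
  `|fine (W (f x @^-1` cube z r)) / (2 * r) ^+ d - phi x z| <= `|C1| * (d%:R * r).
Proof.
move=> r0; set eta := `|C1| * _; have mc := measurable_cube z r.
have eta0 : 0 <= eta by rewrite /eta !mulr_ge0// ltW.
have v0 : 0 < (2 * r) ^+ d by rewrite exprn_gt0// mulr_gt0.
have osc y : cube z r y -> `|phi x y - phi x z| <= eta.
  move=> zy; rewrite distrC; apply: le_trans (phi_lip x z y) _.
  apply: (@le_trans _ _ (`|C1| * eucl z y)).
    by rewrite ler_wpM2r ?eucl_ge0 ?ler_norm.
  by rewrite ler_wpM2l// eucl_cube_le// ltW.
have mphi : measurable_fun (cube z r) (EFin \o phi x).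
  by apply: measurable_funTS; apply/measurable_EFinP; exact: measurable_density.
have intc k : 0 <= k -> (\int[lam]_(y in cube z r) k%:E = (k * (2 * r) ^+ d)%:E)%E.
  by move=> k0; rewrite integral_cst// lebesgue_cube// ltW.
rewrite fphi//.
set I := (\int[lam]_(y in _) _)%E.
have I0 : (0 <= I)%E by apply: integral_ge0 => y _; rewrite lee_fin ltW.
have Ile : (I <= ((phi x z + eta) * (2 * r) ^+ d)%:E)%E.
  rewrite -intc; last by rewrite addr_ge0// ltW.
  apply: ge0_le_integral => //.
  - by move=> y _; rewrite lee_fin ltW.
  - by move=> y /osc; rewrite lee_fin ler_norml => /andP[_ h]; lra.
have Ifin : I \is a fin_num by rewrite ge0_fin_numE// (le_lt_trans Ile)// ltry.
have leI : ((phi x z * (2 * r) ^+ d)%:E <= I + (eta * (2 * r) ^+ d)%:E)%E.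
  rewrite -!intc//; last exact: ltW.
  rewrite -ge0_integralD//; first apply: ge0_le_integral => //.
  - by move=> y _; rewrite lee_fin ltW.
  - exact: emeasurable_funD.
  - by move=> y /osc; rewrite -EFinD lee_fin ler_norml => /andP[h _]; lra.
  - by move=> y _; rewrite lee_fin ltW.
move: Ile leI; rewrite -(fineK Ifin) -EFinD !lee_fin => Ile leI.
rewrite ler_norml lerBrDr lerBlDr ler_pdivrMr// ler_pdivlMr//.
by apply/andP; split; lra.
Qed.

(** The cube averages are measures of sections of the measurable sets [E n], hence jointly
    measurable in (x, z), and they converge pointwise to the density. *)
Lemma measurable_joint_density : measurable_fun [set: X * X] (fun p => phi p.1 p.2).
Proof.
pose r n : R := n.+1%:R^-1.
have r0 n : 0 < r n by rewrite invr_gt0.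
pose E n : set ((X * X) * X) := [set q | cube q.1.2 (r n) (f q.1.1 q.2)].
have mE n : measurable (E n).
  rewrite (_ : E n = \bigcap_(i in [set: 'I_d])
    ((fun q : (X * X) * X => tnth q.1.2 i - tnth (f q.1.1 q.2) i) @^-1` `[- r n, r n])).
    apply: fin_bigcap_measurable => [|i _]; first exact: finite_finset.
    rewrite -[X in measurable X]setTI; apply: (_ : measurable_fun setT _) => //.
    apply: measurable_funB.
      apply: (measurableT_comp (@measurable_tnth _ _ _ i)).
      exact: (measurableT_comp measurable_snd measurable_fst).
    apply: (measurableT_comp (@measurable_tnth _ _ _ i)).
    apply: (measurableT_comp mf (g := fun q : (X * X) * X => (q.1.1, q.2))).
    apply: measurable_fun_pair => //.
    exact: (measurableT_comp measurable_fst measurable_fst).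
  apply/seteqP; split => q /=; first by move=> /cubeP h i _ /=; rewrite in_itv/= -ler_norml.
  by move=> h; apply/cubeP => i; have := h i I; rewrite /= in_itv/= -ler_norml.
apply: (@measurable_fun_cvg _ _ _ _
  (fun n p => fine ((W \o xsection (E n)) p) / (2 * r n) ^+ d)) => //.
  move=> n; apply: measurable_funM => //.
  apply: (measurableT_comp (fine_measurable measurableT)) => //.
  exact: measurable_fun_xsection.
move=> [x z] _ /=; apply/cvgrPdist_le => e e0.
have sec n : xsection (E n) (x, z) = f x @^-1` cube z (r n).
  by apply/seteqP; split => w; rewrite /xsection/= inE.
pose K : R := `|C1| * d%:R.
exists (Num.truncn (K / e)) => // n /= hn; rewrite sec distrC.
apply: le_trans (density_average x z (r0 n)) _.
rewrite /r mulrA ler_pdivrMr// [leRHS]mulrC -ler_pdivrMr//.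
apply: le_trans (ltW (truncnS_gt _)) _; rewrite ler_nat ltnS; exact: hn.
Qed.

End measurability.

(** * Setwise comparison of integrals, and measures with densities *)

Section measure_lemmas.
Context {dX : measure_display} {X : measurableType dX} {R : realType}.
Local Open Scope ereal_scope.

Import HBNNSimple.

(** The integral is built from simple functions, which only see measurable sets. This lets bare set
    functions be traded for genuine probabilities. *)
Lemma integral_eq_on_measurable (mu : set X -> \bar R) (P : {measure set X -> \bar R})
    (D : set X) (f : X -> \bar R) :
  (forall A, measurable A -> mu A = P A) ->
  \int[mu]_(x in D) f x = \int[P]_(x in D) f x.
Proof.
move=> muP; have sE (h : {nnsfun X >-> R}) : sintegral mu h = sintegral P h.
  by apply: eq_fsbigr => r _; rewrite muP//; exact: measurable_funPTI.
rewrite /integral; congr (ereal_sup _ - ereal_sup _);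
  by apply/seteqP; split => _ [h hf <-]; exists h.
Qed.

Lemma density_probability (mu : {measure set X -> \bar R}) (g : X -> \bar R) :
  measurable_fun [set: X] g -> (forall x, 0 <= g x) -> \int[mu]_x g x = 1 ->
  exists P : probability X R, forall A, measurable A -> P A = \int[mu]_(x in A) g x.
Proof.
move=> mg g0 g1; pose m A := \int[mu]_(x in A) g x.
have m0 : m set0 = 0 by rewrite /m integral_set0.
have m_ge0 A : 0 <= m A by apply: integral_ge0.
have msig : semi_sigma_additive m.
  move=> F mF tF mUF; rewrite /m ge0_integral_bigcup//; last exact: measurable_funTS.
  by apply: is_cvg_ereal_nneg_natsum_cond => n _ _; exact: integral_ge0.
pose m' : {measure set X -> \bar R} :=
  HB.pack m (isMeasure.Build _ _ _ m m0 m_ge0 msig).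
have m1 : m' setT = 1 by [].
pose P : probability X R := HB.pack m
  (isMeasure.Build _ _ _ m m0 m_ge0 msig) (Measure_isProbability.Build _ _ _ m' m1).
by exists P.
Qed.

(** With [count_steps_le], a discrete layer-cake formula: counting the levels below y recovers y up
    to an error of 1. *)
Lemma count_steps_ge (n : nat) (y : R) : (y <= n%:R)%R ->
  (y <= \sum_(k < n) (k%:R < y)%R%:R)%R.
Proof.
elim: n => [|n ih] yn; first by rewrite big_ord0.
rewrite big_ord_recr /=; have [ny|ny] := ltP; last by rewrite addr0 ih.
rewrite (eq_bigr (fun=> 1%R)) => [|k _]; last first.
  by rewrite (le_lt_trans _ ny)// ler_nat ltnW.
by rewrite sumr_const card_ord natr1.
Qed.

Lemma count_steps_le (n : nat) (y : R) : (0 <= y)%R ->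
  (\sum_(k < n) (k%:R < y)%R%:R <= y + 1)%R.
Proof.
move=> y0; elim: n => [|n ih]; first by rewrite big_ord0 addr_ge0.
rewrite big_ord_recr /=; have [ny|ny] := ltP; last by rewrite addr0.
rewrite (@le_trans _ _ (\sum_(k < n) 1 + 1)%R)//.
  by rewrite lerD2r; apply: ler_sum => k _; case: ltP.
by rewrite sumr_const card_ord lerD2r ltW.
Qed.

(* The integral is compared through the level sets [g > k c] for a small mesh c. *)
Lemma integral_le_setwise (P P' : probability X R) (D D' : set X) (g : X -> R) (b dl : R) :
  measurable D -> measurable D' -> measurable_fun [set: X] g ->
  (forall x, 0 <= g x <= b)%R -> (0 <= dl)%R ->
  (forall A, measurable A -> P (A `&` D) <= P' (A `&` D') + dl%:E) ->
  \int[P]_(x in D) (g x)%:E <= \int[P']_(x in D') (g x)%:E + (b * dl)%:E.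
Proof.
move=> mD mD' mg g0b dl0 PP'.
have g0 x : (0 <= g x)%R by case/andP: (g0b x).
(* Here [g] vanishes; the mesh below needs a positive bound. *)
have [b0|b0] := leP b 0%R.
  have gx0 x : g x = 0%R.
    by apply/eqP; rewrite eq_le g0 andbT; case/andP: (g0b x) => _ /le_trans ->.
  have b00 : b = 0%R by apply/eqP; rewrite eq_le b0/=; case/andP: (g0b point); exact: le_trans.
  by under eq_integral do rewrite gx0; rewrite integral0 b00 mul0r adde0 integral_ge0// => x _;
    rewrite lee_fin.
apply/lee_addgt0Pr => e e0.
pose n := (Num.truncn (b / e)).+1.
pose c : R := (b / n%:R)%R.
have n0 : (0 < n%:R :> R)%R by rewrite ltr0n.
have c0 : (0 < c)%R by rewrite divr_gt0.
have ce : (c <= e)%R.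
  rewrite /c ler_pdivrMr// mulrC -ler_pdivrMr//; exact/ltW/truncnS_gt.
pose A (k : nat) : set X := [set x | (k%:R < g x / c)%R].
have mA k : measurable (A k).
  rewrite (_ : A k = g @^-1` `](k%:R * c)%R, +oo[).
    by rewrite -[X in measurable X]setTI; exact: mg.
  by apply/seteqP; split => x; rewrite /A/= in_itv/= andbT ltr_pdivlMr.
pose s x := (\sum_(k < n) c%:E * (\1_(A k) x)%:E).
have sE x : s x = (c * \sum_(k < n) (k%:R < g x / c)%R%:R)%:E.
  rewrite /s mulr_sumr -sumEFin; apply: eq_bigr => k _; rewrite -EFinM.
  congr (c * _)%:E; rewrite indicE; congr ((nat_of_bool _)%:R)%R.
  by apply/idP/idP; rewrite inE.
have gs x : (g x)%:E <= s x.
  rewrite sE lee_fin -ler_pdivrMl// mulrC count_steps_ge//.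
  rewrite ler_pdivrMr// /c mulrC divfK ?gt_eqF//.
  by case/andP: (g0b x).
have sg x : s x <= (g x)%:E + c%:E.
  rewrite sE -EFinD lee_fin.
  have : (\sum_(k < n) (k%:R < g x / c)%R%:R <= g x / c + 1)%R.
    by apply: count_steps_le; rewrite divr_ge0// ltW.
  move=> h; apply: (@le_trans _ _ (c * (g x / c + 1))%R); first by rewrite ler_pM2l.
  by rewrite mulrDr mulr1 mulrC divfK// gt_eqF.
have mi k E : measurable_fun E (fun x => c%:E * (\1_(A k) x)%:E).
  apply: measurable_funTS; apply/measurable_EFinP => /=.
  by apply: measurable_funM => //; exact: measurable_indic.
have ms E : measurable_fun E s by apply: emeasurable_sum.
have i0 k x : 0 <= c%:E * (\1_(A k) x)%:E by rewrite mule_ge0// lee_fin// ltW.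
have mEg E : measurable_fun E (EFin \o g) by apply/measurable_funTS/measurable_EFinP.
have intsE (Q : probability X R) E : measurable E ->
    \int[Q]_(x in E) s x = \sum_(k < n) c%:E * Q (A k `&` E).
  move=> mE; rewrite ge0_integral_sum//; apply: eq_bigr => k _.
  rewrite ge0_integralZl_EFin//; last exact: ltW.
  - by rewrite integral_indic.
  - by apply/measurable_EFinP/measurable_indic.
have le1 : \int[P]_(x in D) (g x)%:E <= \int[P]_(x in D) s x.
  by apply: ge0_le_integral => // x _; rewrite lee_fin.
have le2 : \int[P]_(x in D) s x <= \int[P']_(x in D') s x + (b * dl)%:E.
  rewrite !intsE//.
  (* Each of the n levels costs c dl, so the total is b dl whatever the mesh. *)
  have -> : (b * dl)%:E = \sum_(k < n) (c * dl)%:E.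
    rewrite sumEFin sumr_const card_ord -mulr_natl; congr (_%:E).
    by rewrite /c mulrA mulrCA divff ?mulr1// gt_eqF.
  rewrite -big_split/=; apply: lee_sum => k _.
  rewrite (EFinM c dl) -ge0_muleDr ?lee_fin//.
  by rewrite lee_pmul2l// PP'.
have le3 : \int[P']_(x in D') s x <= \int[P']_(x in D') (g x)%:E + c%:E.
  apply: (@le_trans _ _ (\int[P']_(x in D') ((g x)%:E + c%:E))).
    apply: ge0_le_integral => //.
    - by move=> x _; apply: sume_ge0.
    - by apply: emeasurable_funD.
  rewrite ge0_integralD//.
  - rewrite leeD2l// integral_cst// -[leRHS]mule1 lee_pmul2l ?lte_fin//.
    exact: probability_le1.
  - by move=> x _; rewrite lee_fin.
  - by move=> x _; rewrite lee_fin ltW.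
apply: (le_trans le1); apply: (le_trans le2).
rewrite [leRHS]addeAC.
apply: (@leeD _ _ _ (_ * _)%:E _) => //.
by apply: (le_trans le3); rewrite leeD2l// lee_fin.
Qed.

Lemma absolutely_continuous_negligible (mu : {measure set X -> \bar R})
    (P : set X -> \bar R) (g : X -> R) (N : set X) :
  measurable_fun [set: X] g ->
  (forall A, measurable A -> P A = \int[mu]_(x in A) (g x)%:E) ->
  measurable N -> mu N = 0 -> P N = 0.
Proof.
move=> mg PE mN N0; rewrite PE// null_set_integral//.
exact/measurable_funTS/measurable_EFinP.
Qed.

End measure_lemmas.

(** Packages sigma-finiteness into the structure under which Tonelli's theorem applies to [lam]. *)
Lemma sigma_finite_measure_of d (X : measurableType d) (R : realType)
    (lam : {measure set X -> \bar R}) : sigma_finite setT lam ->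
  exists lam' : {sigma_finite_measure set X -> \bar R}, lam = lam' :> (set X -> \bar R).
Proof.
move=> h; pose m : set X -> \bar R := lam.
pose mm : isMeasure d X R m := isMeasure.Build _ _ _ m
  (measure0 lam) (measure_ge0 lam) (@measure_semi_sigma_additive _ _ _ lam).
pose m' : {measure set X -> \bar R} := HB.pack m mm.
pose m'' : {sigma_finite_measure set X -> \bar R} :=
  HB.pack m mm (Measure_isSigmaFinite.Build _ _ _ m' h).
by exists m''.
Qed.

(** * Tonelli's theorem for mixtures of transition densities *)

Section transition_density.
Context {dX : measure_display} {X : measurableType dX} {R : realType}.
Variables (lam : {sigma_finite_measure set X -> \bar R}) (phi : X -> X -> R).
Hypothesis mphi : measurable_fun [set: X * X] (fun p => phi p.1 p.2).
Hypothesis phi_ge0 : forall x z, (0 <= phi x z)%R.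
Local Open Scope ereal_scope.

(** Indicators inside the integrand turn integrals over D and A into integrals over the whole
    product space. *)
Let h (D A : set X) (p : X * X) : \bar R := (phi p.1 p.2 * (\1_D p.1 * \1_A p.2))%:E.

Let mh D A : measurable D -> measurable A -> measurable_fun [set: X * X] (h D A).
Proof.
move=> mD mA; apply/measurable_EFinP; apply: measurable_funM => //.
by apply: measurable_funM; (apply: measurableT_comp; [exact: measurable_indic|by []]).
Qed.

Let h_ge0 D A p : 0 <= h D A p.
Proof. by rewrite lee_fin mulr_ge0. Qed.

Let int_h1 D A x : \int[lam]_z h D A (x, z) = ((fun x => \int[lam]_(z in A) (phi x z)%:E) \_ D) x.
Proof.
rewrite patchE; case: ifPn => xD; last first.
  by rewrite integral0_eq// => z _; rewrite /h/= indicE (negbTE xD) mul0r mulr0.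
rewrite [RHS]integral_mkcond; apply: eq_integral => z _.
by rewrite patchE /h/= !indicE xD mul1r; case: ifP => _; rewrite ?mulr1 ?mulr0.
Qed.

Let int_h2 (P : probability X R) D A z :
  \int[P]_x h D A (x, z) = ((fun z => \int[P]_(x in D) (phi x z)%:E) \_ A) z.
Proof.
rewrite patchE; case: ifPn => zA; last first.
  by rewrite integral0_eq// => x _; rewrite /h/= [X in (_ * X)%R]mulrC indicE (negbTE zA) mul0r mulr0.
rewrite [RHS]integral_mkcond; apply: eq_integral => x _.
by rewrite patchE /h/= !indicE zA mulr1; case: ifP => _; rewrite ?mulr1 ?mulr0.
Qed.

Lemma measurable_transition A : measurable A ->
  measurable_fun [set: X] (fun x => \int[lam]_(z in A) (phi x z)%:E).
Proof.
move=> mA; have := measurable_fun_fubini_tonelli_F (m2 := lam) (h setT A) (mh measurableT mA) (h_ge0 setT A).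
by apply: eq_measurable_fun => x _; rewrite /fubini_F int_h1 patchE in_setT.
Qed.

Lemma measurable_mixture (P : probability X R) D : measurable D ->
  measurable_fun [set: X] (fun z => \int[P]_(x in D) (phi x z)%:E).
Proof.
move=> mD; have := measurable_fun_fubini_tonelli_G (m1 := P) (h D setT) (mh mD measurableT) (h_ge0 D setT).
by apply: eq_measurable_fun => x _; rewrite /fubini_G int_h2 patchE in_setT.
Qed.

Lemma mixture_tonelli (P : probability X R) D A : measurable D -> measurable A ->
  \int[lam]_(z in A) \int[P]_(x in D) (phi x z)%:E =
  \int[P]_(x in D) \int[lam]_(z in A) (phi x z)%:E.
Proof.
move=> mD mA; have := fubini_tonelli (m1 := P) (m2 := lam) (h D A) (mh mD mA) (h_ge0 D A).
under eq_integral do rewrite int_h1.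
under [in RHS]eq_integral do rewrite int_h2.
by rewrite -!integral_mkcond.
Qed.

End transition_density.

(** * Total variation estimates for filters *)

Section tv_estimates.
Context {R : realType} {dX : measure_display} {X : measurableType dX}.
Local Open Scope ereal_scope.
Implicit Types (mu : set X -> \bar R).

(* A set function is only constrained on measurable sets. *)
Definition is_prob mu :=
  exists P : probability X R, forall A, measurable A -> mu A = P A.

(** Distance at most dl, uniformly over events, between mu restricted to D and mu' restricted to D',
    in additive form to avoid differences of extended reals. Two sets D and D' let prior and
    quantizer vary together. *)
Definition close_on mu mu' (D D' : set X) (dl : R) :=
  forall A, measurable A ->
    mu (A `&` D) <= mu' (A `&` D') + dl%:E /\ mu' (A `&` D') <= mu (A `&` D) + dl%:E.

(** The bound [Bd] travels with the Lipschitz constant because a Bellman step also changes the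
    masses that weight the values of V. *)
Definition tv_lipschitz (V : (set X -> \bar R) -> \bar R) (Bd L : R) :=
  (forall mu, is_prob mu -> 0 <= V mu <= Bd%:E) /\
  (forall mu mu' dl, is_prob mu -> is_prob mu' -> (0 <= dl)%R ->
     close_on mu mu' setT setT dl -> V mu <= V mu' + (L * dl)%:E).

Lemma close_on_sym mu mu' D D' dl : close_on mu mu' D D' dl -> close_on mu' mu D' D dl.
Proof. by move=> h A /h[]. Qed.

(** With r = k'/p' in [0, 1], the difference is ((k - k') + r (p' - p)) / p, and each summand of the
    numerator is at most dl in absolute value. *)
Lemma normalized_close (k k' p p' dl : R) : (0 < p)%R -> (0 < p')%R ->
  (0 <= k' <= p')%R -> (0 <= dl)%R ->
  (k <= k' + dl)%R -> (k' <= k + dl)%R -> (p <= p' + dl)%R -> (p' <= p + dl)%R ->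
  (k / p <= k' / p' + 2 * dl / p)%R /\ (k' / p' <= k / p + 2 * dl / p)%R.
Proof.
move=> p0 p'0 /andP[k'0 k'p'] dl0 kk' k'k pp' p'p.
pose r := (k' / p')%R.
have r0 : (0 <= r)%R by rewrite divr_ge0// ltW.
have r1 : (r <= 1)%R by rewrite ler_pdivrMr// mul1r.
have k'E : k' = (r * p')%R by rewrite /r divfK// gt_eqF.
have h1 : (r * p' <= r * (p + dl))%R by rewrite ler_wpM2l.
have h2 : (r * p <= r * (p' + dl))%R by rewrite ler_wpM2l.
have h3 : (r * dl <= dl)%R by rewrite ler_piMl.
move: h1 h2; rewrite !mulrDr -k'E => h1 h2.
by split; rewrite -/r -(ler_pM2r p0) !mulrDl !divfK ?gt_eqF//; lra.
Qed.

End tv_estimates.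

Section filter.
Context {R : realType} {d M : nat}.
Local Notation X := (d.-tuple R).
Local Open Scope ereal_scope.
Variables (lam : {sigma_finite_measure set X -> \bar R}) (phi : X -> X -> R).
Hypothesis mphi : measurable_fun [set: X * X] (fun p => phi p.1 p.2).
Hypothesis phi_ge0 : forall x z, (0 <= phi x z)%R.
Hypothesis phi1 : forall x, \int[lam]_z (phi x z)%:E = 1.

Let mphi2 x : measurable_fun [set: X] (fun z => (phi x z)%:E).
Proof. by apply/measurable_EFinP; exact: (measurable_fun_pair2 x mphi). Qed.

Lemma filter_update_eq (mu : set X -> \bar R) (P : probability X R) (Q : X -> 'I_M) m :
  (forall A, measurable A -> mu A = P A) -> measurable (cell Q m) ->
  filter_update lam phi m mu Q = filter_update lam phi m P Q.
Proof.
move=> muP mQ; apply/funext => A; rewrite /filter_update muP//; congr (_ * _).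
by apply: eq_integral => z _; exact: integral_eq_on_measurable.
Qed.

Let transition_int_le1 (P : probability X R) D A : measurable D -> measurable A ->
  \int[P]_(x in D) \int[lam]_(z in A) (phi x z)%:E <= P D.
Proof.
move=> mD mA; rewrite -[leRHS]mul1e -(integral_cst P mD 1%E).
apply: ge0_le_integral => //.
- by move=> x _; apply: integral_ge0 => z _; rewrite lee_fin.
- exact/measurable_funTS/measurable_transition.
- move=> x _; rewrite -(phi1 x); apply: ge0_subset_integral => //.
  by move=> z _; rewrite lee_fin.
Qed.

Lemma filter_update_prob (P : probability X R) (Q : X -> 'I_M) m :
  measurable (cell Q m) -> P (cell Q m) != 0 -> is_prob (filter_update lam phi m P Q).
Proof.
move=> mQ P0; set D := cell Q m in mQ P0 *.
have Pfin : P D \is a fin_num by exact: fin_num_measure.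
have p0 : (0 < fine (P D))%R by rewrite fine_gt0// lt0e P0 measure_ge0/= ltey_eq Pfin.
have mG : measurable_fun [set: X] (fun z => \int[P]_(x in D) (phi x z)%:E).
  exact: measurable_mixture.
have G0 z : 0 <= \int[P]_(x in D) (phi x z)%:E by apply: integral_ge0 => x _; rewrite lee_fin.
have i0 : (0 <= (fine (P D))^-1)%R by rewrite invr_ge0 ltW.
have fuE A : measurable A -> \int[lam]_(z in A)
    (((fine (P D))^-1)%:E * \int[P]_(x in D) (phi x z)%:E) = filter_update lam phi m P Q A.
  by move=> mA; rewrite ge0_integralZl_EFin//; exact: measurable_funTS.
have [|||P' P'E] := density_probability (mu := lam)
    (g := fun z => ((fine (P D))^-1)%:E * \int[P]_(x in D) (phi x z)%:E).
- exact: measurable_funeM.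
- by move=> z; rewrite mule_ge0.
- rewrite fuE// /filter_update mixture_tonelli//.
  under eq_integral do rewrite phi1.
  by rewrite integral_cst// mul1e -[X in _ * X](fineK Pfin) -EFinM mulVf// gt_eqF.
- by exists P' => A mA; rewrite P'E// fuE.
Qed.

(** By Tonelli the unnormalised filter at A is the integral over the cell of the transition
    probability into A, a function with values in [0, 1]; [integral_le_setwise] moves it by dl and
    [normalized_close] handles the division. *)
Lemma filter_update_close (P P' : probability X R) (Q Q' : X -> 'I_M) m (dl : R) :
  measurable (cell Q m) -> measurable (cell Q' m) -> (0 <= dl)%R ->
  P (cell Q m) != 0 -> P' (cell Q' m) != 0 ->
  close_on P P' (cell Q m) (cell Q' m) dl ->
  close_on (filter_update lam phi m P Q) (filter_update lam phi m P' Q') setT setT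
    (2 * dl / fine (P (cell Q m))).
Proof.
move=> mQ mQ' dl0 P0 P'0 PP' A mA; rewrite !setIT.
set D := cell Q m in mQ P0 PP' *; set D' := cell Q' m in mQ' P'0 PP' *.
have Pfin : P D \is a fin_num by exact: fin_num_measure.
have P'fin : P' D' \is a fin_num by exact: fin_num_measure.
have p0 : (0 < fine (P D))%R by rewrite fine_gt0// lt0e P0 measure_ge0/= ltey_eq Pfin.
have p'0 : (0 < fine (P' D'))%R by rewrite fine_gt0// lt0e P'0 measure_ge0/= ltey_eq P'fin.
rewrite /filter_update -/D -/D'.
rewrite (mixture_tonelli lam mphi phi_ge0 P mQ mA) (mixture_tonelli lam mphi phi_ge0 P' mQ' mA).
pose k x : R := fine (\int[lam]_(z in A) (phi x z)%:E).
have kE x : \int[lam]_(z in A) (phi x z)%:E = (k x)%:E.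
  rewrite /k fineK// ge0_fin_numE; last by apply: integral_ge0 => z _; rewrite lee_fin.
  apply: (@le_lt_trans _ _ 1); last exact: ltry.
  rewrite -(phi1 x); apply: ge0_subset_integral => //.
  by move=> z _; rewrite lee_fin.
have k01 x : (0 <= k x <= 1)%R.
  rewrite -!lee_fin -kE; apply/andP; split.
    by apply: integral_ge0 => z _; rewrite lee_fin.
  rewrite -(phi1 x); apply: ge0_subset_integral => //.
  by move=> z _; rewrite lee_fin.
have mk : measurable_fun [set: X] k.
  apply/measurable_EFinP; apply: eq_measurable_fun (measurable_transition lam mphi phi_ge0 mA).
  by move=> x _; rewrite kE.
have kint (P1 : probability X R) E : \int[P1]_(x in E) \int[lam]_(z in A) (phi x z)%:E =
    \int[P1]_(x in E) (k x)%:E by apply: eq_integral => x _; rewrite kE.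
have le1 := transition_int_le1 P' mQ' mA.
rewrite kint in le1; rewrite !kint.
have h1 := integral_le_setwise mQ mQ' mk k01 dl0 (fun B mB => (PP' B mB).1).
have h2 := integral_le_setwise mQ' mQ mk k01 dl0 (fun B mB => (PP' B mB).2).
have [h3 h4] := PP' setT measurableT.
move: h1 h2 h3 h4 le1; rewrite mul1r !setTI -/D -/D'.
have k0 x : (0 <= k x)%R by case/andP: (k01 x).
have i0 : 0 <= \int[P]_(x in D) (k x)%:E by apply: integral_ge0 => x _; rewrite lee_fin.
have i'0 : 0 <= \int[P']_(x in D') (k x)%:E by apply: integral_ge0 => x _; rewrite lee_fin.
move=> h1 h2 h3 h4 le1.
have i'fin : \int[P']_(x in D') (k x)%:E \is a fin_num.
  by rewrite ge0_fin_numE// (le_lt_trans le1)// ltey_eq P'fin.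
have ifin : \int[P]_(x in D) (k x)%:E \is a fin_num.
  by rewrite ge0_fin_numE// (le_lt_trans h1)// -(fineK i'fin) -EFinD ltry.
move: h1 h2 h3 h4 le1 i'0 i0; rewrite -(fineK ifin) -(fineK i'fin) -(fineK Pfin) -(fineK P'fin).
rewrite /= -!EFinM -!EFinD !lee_fin => h1 h2 h3 h4 le1 i'0 i0.
have [|h5 h6] := normalized_close p0 p'0 _ dl0 h1 h2 h3 h4; first by rewrite i'0.
by rewrite ![((fine (P D))^-1 * _)%R]mulrC ![((fine (P' D'))^-1 * _)%R]mulrC.
Qed.

End filter.

(** * Bounds for one Bellman step *)

Lemma ereal_inf_image_le (R : realType) (I : Type) (S : set I) (f g : I -> \bar R) (c : R) :
  (forall i, S i -> (f i <= g i + c%:E)%E) ->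
  (ereal_inf [set f i | i in S] <= ereal_inf [set g i | i in S] + c%:E)%E.
Proof.
move=> fg; rewrite -leeBlDr//; apply: le_ereal_inf_tmp => _ [i Si <-].
rewrite leeBlDr//; apply: le_trans (fg i Si).
by apply: ereal_inf_lbound; exists i.
Qed.

Section bellman.
Context {R : realType} {d M : nat}.
Local Notation X := (d.-tuple R).
Local Open Scope ereal_scope.
Variables (lam : {sigma_finite_measure set X -> \bar R}) (phi : X -> X -> R).
Hypothesis mphi : measurable_fun [set: X * X] (fun p => phi p.1 p.2).
Hypothesis phi_ge0 : forall x z, (0 <= phi x z)%R.
Hypothesis phi1 : forall x, \int[lam]_z (phi x z)%:E = 1.
Variables (U : topologicalType) (c0 : X -> U -> R) (B : R) (T : nat).
Hypothesis U0 : [set: U] !=set0.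
Hypothesis c0_bounds : forall x u, (0 <= c0 x u <= B)%R.
Hypothesis mc0 : forall u, measurable_fun [set: X] (c0 ^~ u).
Hypothesis T0 : (1 <= T)%N.

Let B0 : (0 <= B)%R.
Proof.
have [u _] := U0; have /andP[] := c0_bounds [tuple 0%R | _ < d] u; exact: le_trans.
Qed.

Local Notation term V m mu Q := (if mu (cell Q m) == 0 then 0
  else V (filter_update lam phi m mu Q) * mu (cell Q m)).

(** The filters are 2 dl / p apart; times L and weighted by p this leaves 2 L dl. The change of the
    weight itself costs Bd dl. *)
Let term_le V (Bd L dl : R) (P P' : probability X R) (Q Q' : X -> 'I_M) m :
  tv_lipschitz V Bd L -> (0 <= Bd)%R -> (0 <= L)%R -> (0 <= dl)%R ->
  measurable (cell Q m) -> measurable (cell Q' m) ->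
  close_on P P' (cell Q m) (cell Q' m) dl ->
  term V m P Q <= term V m P' Q' + ((Bd + 2 * L) * dl)%:E.
Proof.
move=> [Vb VL] Bd0 L0 dl0 mQ mQ' PP'.
have [PQ P'Q'] : P (cell Q m) <= P' (cell Q' m) + dl%:E /\ P' (cell Q' m) <= P (cell Q m) + dl%:E.
  by have := PP' setT measurableT; rewrite !setTI.
have Pfin : P (cell Q m) \is a fin_num by exact: fin_num_measure.
have P'fin : P' (cell Q' m) \is a fin_num by exact: fin_num_measure.
have c_ge0 : (0 <= (Bd + 2 * L) * dl)%R by rewrite mulr_ge0// addr_ge0// mulr_ge0.
have [P0|P0] := eqVneq (P (cell Q m)) 0.
  rewrite adde_ge0 ?lee_fin//; case: eqVneq => // P'0.
  by rewrite mule_ge0//; have /andP[] := Vb _ (filter_update_prob mphi phi_ge0 phi1 mQ' P'0).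
have /Vb/andP[V0 VBd] := filter_update_prob mphi phi_ge0 phi1 mQ P0.
(* There is no second filter to compare with, but then the first cell has mass at most dl and
   boundedness of V suffices. *)
have [P'0|P'0] := eqVneq (P' (cell Q' m)) 0.
  rewrite add0e; apply: (@le_trans _ _ (Bd%:E * dl%:E)).
    by apply: lee_pmul => //; rewrite -[leRHS]add0e -P'0.
  by rewrite -EFinM lee_fin ler_wpM2r// lerDl mulr_ge0.
have p0 : (0 < fine (P (cell Q m)))%R by rewrite fine_gt0// lt0e P0 measure_ge0/= ltey_eq Pfin.
have fuP := filter_update_prob mphi phi_ge0 phi1 mQ P0.
have fuP' := filter_update_prob mphi phi_ge0 phi1 mQ' P'0.
have close := filter_update_close mphi phi_ge0 phi1 mQ mQ' dl0 P0 P'0 PP'.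
have := VL _ _ _ fuP fuP' _ close.
have /Vb/andP[V'0 V'Bd] := fuP'.
have -> : (0 <= 2 * dl / fine (P (cell Q m)))%R by rewrite divr_ge0 ?mulr_ge0// ltW.
move=> /(_ isT).
set v := V _ in V0 VBd *; set v' := V _ in V'0 V'Bd *.
have vfin : v \is a fin_num by rewrite ge0_fin_numE// (le_lt_trans VBd)// ltry.
have v'fin : v' \is a fin_num by rewrite ge0_fin_numE// (le_lt_trans V'Bd)// ltry.
move: V'0 V'Bd PQ P'Q' p0.
rewrite -(fineK vfin) -(fineK v'fin) -(fineK Pfin) -(fineK P'fin) /=.
set w := fine v; set w' := fine v'; set p := fine (P _); set p' := fine (P' _).
rewrite -!EFinM -!EFinD !lee_fin => w'0 w'Bd pp' p'p p0 ww'.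
have h1 : (w * p <= (w' + L * (2 * dl / p)) * p)%R by rewrite ler_pM2r.
have h2 : ((w' + L * (2 * dl / p)) * p = w' * p + 2 * L * dl)%R by field; rewrite gt_eqF.
have h3 : (w' * p <= w' * (p' + dl))%R by rewrite ler_wpM2l.
have h4 : (w' * dl <= Bd * dl)%R by rewrite ler_wpM2r.
by move: h1 h3; rewrite h2 mulrDr mulrDl => h1 h3; lra.
Qed.

Let cost_le (dl : R) (P P' : probability X R) (Q Q' : X -> 'I_M) :
  (0 <= dl)%R -> (forall m, measurable (cell Q m)) -> (forall m, measurable (cell Q' m)) ->
  (forall m, close_on P P' (cell Q m) (cell Q' m) dl) ->
  cost c0 P Q <= cost c0 P' Q' + (M%:R * (B * dl))%:E.
Proof.
move=> dl0 mQ mQ' PP'; rewrite /cost.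
have -> : (M%:R * (B * dl))%:E = \sum_(i < M) (B * dl)%:E.
  by rewrite sumEFin sumr_const card_ord mulr_natl.
rewrite -big_split/=; apply: lee_sum => m _; apply: ereal_inf_image_le => u _.
by apply: integral_le_setwise => // A mA; exact: (PP' m A mA).1.
Qed.

Let cost_bounds (P : probability X R) (Q : X -> 'I_M) :
  (forall m, measurable (cell Q m)) -> 0 <= cost c0 P Q <= (M%:R * B)%:E.
Proof.
move=> mQ; apply/andP; split.
  apply: sume_ge0 => m _; apply: le_ereal_inf_tmp => _ [u _ <-].
  by apply: integral_ge0 => x _; rewrite lee_fin; case/andP: (c0_bounds x u).
have -> : (M%:R * B)%:E = \sum_(i < M) B%:E.
  by rewrite sumEFin sumr_const card_ord mulr_natl.
apply: lee_sum => m _; have [u _] := U0.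
apply: (@le_trans _ _ (\int[P]_(x in cell Q m) (c0 x u)%:E)).
  by apply: ereal_inf_lbound; exists u.
apply: (@le_trans _ _ (\int[P]_(x in cell Q m) B%:E)).
  apply: ge0_le_integral => //.
  - by move=> x _; rewrite lee_fin; case/andP: (c0_bounds x u).
  - by apply/measurable_EFinP; exact: measurable_funTS.
  - by move=> x _; rewrite lee_fin; case/andP: (c0_bounds x u).
rewrite integral_cst// -[leRHS]mule1 lee_wpmul2l ?lee_fin//.
exact: probability_le1.
Qed.

Let Tinv : (0 <= (T%:R^-1 : R) <= 1)%R.
Proof. by rewrite invr_ge0 ler0n invf_le1 ?ltr0n// ler1n. Qed.

(** Each of the M cells contributes B for the cost, the factor 1/T being bounded by 1, and the
    constant of [term_le] or its bound for the continuation. *)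
Definition step_bound (Bd : R) : R := (M%:R * (B + Bd))%R.
Definition step_lip (Bd L : R) : R := (M%:R * (B + (Bd + 2 * L)))%R.

Lemma objective_eq (V : (set X -> \bar R) -> \bar R) (mu : set X -> \bar R) (P : probability X R)
    (Q : X -> 'I_M) :
  (forall A, measurable A -> mu A = P A) -> inQc Q ->
  objective lam phi c0 T V mu Q = objective lam phi c0 T V P Q.
Proof.
move=> muP Qc; have mQ m : measurable (cell Q m) by case: (Qc m).
rewrite /objective /cost; congr (_ * _ + _).
  apply: eq_bigr => m _; congr ereal_inf; apply: eq_imagel => u _.
  exact: integral_eq_on_measurable.
by apply: eq_bigr => m _; rewrite (muP _ (mQ m)) (filter_update_eq lam phi muP (mQ m)).
Qed.

Lemma objective_bounds V Bd L (P : probability X R) (Q : X -> 'I_M) :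
  tv_lipschitz V Bd L -> (0 <= Bd)%R -> inQc Q ->
  0 <= objective lam phi c0 T V P Q <= (step_bound Bd)%:E.
Proof.
move=> [Vb _] Bd0 Qc; have mQ m : measurable (cell Q m) by case: (Qc m).
have /andP[Ti0 Ti1] := Tinv; have /andP[c_ge0 c_le] := cost_bounds P mQ.
have term_bounds m : 0 <= term V m P Q <= Bd%:E.
  case: eqVneq => [_|P0]; first by rewrite lexx lee_fin.
  have /Vb/andP[V0 VBd] := filter_update_prob mphi phi_ge0 phi1 (mQ m) P0.
  rewrite mule_ge0//= -[leRHS]mule1; apply: lee_pmul => //.
  exact: probability_le1.
apply/andP; split.
  rewrite adde_ge0 ?mule_ge0 ?lee_fin//.
  by apply: sume_ge0 => m _; case/andP: (term_bounds m).
rewrite /step_bound mulrDr EFinD; apply: leeD.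
  by rewrite -[leRHS]mul1e; apply: lee_pmul => //; rewrite lee_fin.
have -> : (M%:R * Bd)%:E = \sum_(i < M) Bd%:E.
  by rewrite sumEFin sumr_const card_ord mulr_natl.
by apply: lee_sum => m _; case/andP: (term_bounds m).
Qed.

(** Equal quantizers give the Lipschitz step for [Jrem]; equal priors compare a minimising sequence
    with its limit. *)
Lemma objective_le V Bd L dl (P P' : probability X R) (Q Q' : X -> 'I_M) :
  tv_lipschitz V Bd L -> (0 <= Bd)%R -> (0 <= L)%R -> (0 <= dl)%R -> inQc Q -> inQc Q' ->
  (forall m, close_on P P' (cell Q m) (cell Q' m) dl) ->
  objective lam phi c0 T V P Q <= objective lam phi c0 T V P' Q' + (step_lip Bd L * dl)%:E.
Proof.
move=> VL Bd0 L0 dl0 Qc Qc' PP'.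
have mQ m : measurable (cell Q m) by case: (Qc m).
have mQ' m : measurable (cell Q' m) by case: (Qc' m).
have /andP[Ti0 Ti1] := Tinv.
have -> : (step_lip Bd L * dl)%:E = (M%:R * (B * dl))%:E + (M%:R * ((Bd + 2 * L) * dl))%:E.
  by rewrite /step_lip -EFinD; congr (_%:E); ring.
rewrite /objective addeACA; apply: leeD.
  apply: (@le_trans _ _ ((T%:R^-1)%:E * (cost c0 P' Q' + (M%:R * (B * dl))%:E))).
    by rewrite lee_wpmul2l ?lee_fin// cost_le.
  have /andP[c_ge0 _] := cost_bounds P' mQ'.
  rewrite ge0_muleDr//; last by rewrite lee_fin !mulr_ge0.
  by rewrite leeD2l// -EFinM lee_fin ler_piMl// !mulr_ge0.
have -> : (M%:R * ((Bd + 2 * L) * dl))%:E = \sum_(i < M) ((Bd + 2 * L) * dl)%:E.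
  by rewrite sumEFin sumr_const card_ord mulr_natl.
by rewrite -big_split/=; apply: lee_sum => m _; exact: term_le.
Qed.

End bellman.

(** * Stability under a change of quantizer *)

Section quantizer_error.
Context {R : realType} {d M : nat}.
Local Notation X := (d.-tuple R).
Local Open Scope ereal_scope.

Lemma constant_quantizer (m : 'I_M) : inQc (fun _ : X => m).
Proof.
move=> i; split; last by move=> x y t.
by rewrite /cell preimage_cst; case: ifP.
Qed.

Lemma measurable_neq_quantizer (Q Q' : X -> 'I_M) : inQc Q -> inQc Q' ->
  measurable [set x | Q x != Q' x].
Proof.
move=> Qc Qc'.
rewrite (_ : [set x | _] = \bigcup_(m in [set: 'I_M]) (cell Q m `\` cell Q' m)).
  apply: fin_bigcup_measurable => [|m _]; first exact: finite_finset.
  by apply: measurableD; [exact: (Qc m).1|exact: (Qc' m).1].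
apply/seteqP; split => x /=.
  by move=> /eqP h; exists (Q x) => //; split => // h'; apply: h; rewrite h'.
by move=> [m _ [/= -> h]]; apply/eqP => h'; apply: h.
Qed.

Lemma close_on_neq (P : probability X R) (Q Q' : X -> 'I_M) (dl : R) m :
  inQc Q -> inQc Q' -> P [set x | Q x != Q' x] <= dl%:E ->
  close_on P P (cell Q m) (cell Q' m) dl.
Proof.
move=> Qc Qc' Pdl A mA; have mN := measurable_neq_quantizer Qc Qc'.
have mC : measurable (A `&` cell Q m) by apply: measurableI => //; exact: (Qc m).1.
have mC' : measurable (A `&` cell Q' m) by apply: measurableI => //; exact: (Qc' m).1.
split.
  apply: (@le_trans _ _ (P ((A `&` cell Q' m) `|` [set x | Q x != Q' x]))).
    apply: le_measure; rewrite ?inE//; first exact: measurableU.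
    move=> x [Ax Qx]; have [QQ'|/eqP QQ'] := eqVneq (Q x) (Q' x); last by right; apply/eqP.
    by left; split => //; rewrite /cell/= -QQ'.
  by apply: le_trans (measureU2 _ _ _) _ => //; rewrite leeD2l.
apply: (@le_trans _ _ (P ((A `&` cell Q m) `|` [set x | Q x != Q' x]))).
  apply: le_measure; rewrite ?inE//; first exact: measurableU.
  move=> x [Ax Qx]; have [QQ'|/eqP QQ'] := eqVneq (Q x) (Q' x); last by right; apply/eqP.
  by left; split => //; rewrite /cell/= QQ'.
by apply: le_trans (measureU2 _ _ _) _ => //; rewrite leeD2l.
Qed.

(** A point in infinitely many disagreement sets lies on a limit hyperplane, so their limsup is
    null, and continuity from above makes the tail unions [E K] small. Arbitrarily late indices
    suffice for a minimising sequence. *)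
Lemma convex_quantizer_compact_measure (P : probability X R) (Q_ : nat -> X -> 'I_M) :
  (forall a : 'rV[R]_d.+1, dotp a a = 1%R -> P [set x | dotp a (lift1 x) = 0%R] = 0) ->
  (forall n, inQc (Q_ n)) ->
  exists2 Q : X -> 'I_M, inQc Q & forall (e : R) (N : nat), (0 < e)%R ->
    exists2 n, (N <= n)%N & P [set x | Q_ n x != Q x] <= e%:E.
Proof.
move=> Pnull Qc; have [Q cQ [s sk [A A1 Qs]]] := convex_quantizer_compact Qc.
exists Q => // e N e0.
pose H (p : 'I_M * 'I_M) : set X := [set x | dotp (A p.1 p.2) (lift1 x) = 0%R].
have mH p : measurable (H p).
  have := @measurable_dotp_lift1 R d (A p.1 p.2) measurableT [set 0%R] (measurable_set1 0%R).
  by rewrite setTI; congr measurable.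
pose D k : set X := [set x | Q_ (s k) x != Q x].
have mD k : measurable (D k) by exact: measurable_neq_quantizer.
pose E K : set X := \bigcup_(k in [set k | (K <= k)%N]) D k.
have mE K : measurable (E K) by exact: bigcup_measurable.
have mIE : measurable (\bigcap_K E K) by apply: bigcapT_measurable.
have PE0 : P (\bigcap_K E K) = 0.
  apply/eqP; rewrite -measure_le0.
  apply: (@le_trans _ _ (P (\big[setU/set0]_(p : 'I_M * 'I_M) H p))).
    apply: le_measure; rewrite ?inE//; first exact: bigsetU_measurable.
    move=> x Ex; rewrite -bigcup_seq; apply: contrapT => nHx.
    have [|K _ KQ] := Qs x.
      by move=> i j; apply/eqP => Aij; apply: nHx; exists (i, j); rewrite //= mem_index_enum.
    have [k /= Kk] := Ex K I.
    by rewrite /D/= KQ ?eqxx.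
  apply: le_trans (measure_bigsetU_le _ _ mH) _.
  by rewrite big1// => p _; exact: Pnull.
have Ecvg : P (E K) @[K --> \oo] --> P (\bigcap_K E K).
  apply: nonincreasing_cvg_mu => //.
    by rewrite (le_lt_trans (probability_le1 _ _))// ltry.
  move=> m n mn; apply/subsetPset => x [k /= nk Dk]; exists k => //=.
  exact: leq_trans mn nk.
rewrite PE0 in Ecvg.
have [K _ KE] : \forall K \near \oo, P (E K) < e%:E.
  move/fine_cvgP : Ecvg => [_ /cvgrPdist_lt /(_ e e0)].
  apply: filterS => K /=; rewrite sub0r normrN ger0_norm; last by rewrite fine_ge0.
  by rewrite -lte_fin fineK// fin_num_measure.
exists (s (maxn N K)); first exact: leq_trans (leq_maxl _ _) (sk _).
have : P (E K) <= e%:E by apply/ltW/(KE K)/leqnn.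
apply: le_trans; apply: le_measure; rewrite ?inE//; first exact: (mD (maxn N K)).
by move=> x Dx; exists (maxn N K) => //=; exact: leq_maxr.
Qed.

End quantizer_error.

(** * Backward induction and attainment *)

Section bellman_recursion.
Context {R : realType} {d M : nat}.
Local Notation X := (d.-tuple R).
Local Open Scope ereal_scope.
Variables (lam : {sigma_finite_measure set X -> \bar R}) (phi : X -> X -> R).
Hypothesis mphi : measurable_fun [set: X * X] (fun p => phi p.1 p.2).
Hypothesis phi_ge0 : forall x z, (0 <= phi x z)%R.
Hypothesis phi1 : forall x, \int[lam]_z (phi x z)%:E = 1.
Variables (U : topologicalType) (c0 : X -> U -> R) (B : R) (T : nat).
Hypothesis U0 : [set: U] !=set0.
Hypothesis c0_bounds : forall x u, (0 <= c0 x u <= B)%R.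
Hypothesis mc0 : forall u, measurable_fun [set: X] (c0 ^~ u).
Hypothesis T0 : (1 <= T)%N.
Hypothesis M0 : (0 < M)%N.

(** An admissible quantizer, which keeps the infimum from being +oo. *)
Let Qcst (x : X) : 'I_M := Ordinal M0.

Lemma Jrem_tv_lipschitz k : exists Bd L, [/\ (0 <= Bd)%R, (0 <= L)%R &
  tv_lipschitz (Jrem lam phi c0 M T k) Bd L].
Proof.
elim: k => [|k [Bd [L [Bd0 L0 VL]]]].
  exists 0%R, 0%R; split => //; split => [mu _|mu mu' dl _ _ _ _] /=.
    by rewrite lexx.
  by rewrite mul0r adde0.
have B0 : (0 <= B)%R.
  by have [u _] := U0; have /andP[] := c0_bounds [tuple 0%R | _ < d] u; exact: le_trans.
exists (step_bound (M := M) B Bd), (step_lip (M := M) B Bd L); split.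
- by rewrite /step_bound mulr_ge0// addr_ge0.
- by rewrite /step_lip mulr_ge0// !addr_ge0// mulr_ge0.
- split => [mu [P muP]|mu mu' dl [P muP] [P' mu'P] dl0 close] /=.
    apply/andP; split.
      apply: le_ereal_inf_tmp => _ [Q Qc <-]; rewrite (objective_eq _ _ _ _ _ muP)//.
      by case/andP: (objective_bounds mphi phi_ge0 phi1 U0 c0_bounds mc0 T0 P VL Bd0 Qc).
    apply: (@le_trans _ _ (objective lam phi c0 T (Jrem lam phi c0 M T k) mu Qcst)).
      by apply: ereal_inf_lbound; exists Qcst => //; exact: constant_quantizer.
    rewrite (objective_eq _ _ _ _ _ muP); last exact: constant_quantizer.
    by case/andP: (objective_bounds mphi phi_ge0 phi1 U0 c0_bounds mc0 T0 P VL Bd0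
      (constant_quantizer (Ordinal M0))).
  apply: ereal_inf_image_le => Q Qc.
  rewrite (objective_eq _ _ _ _ _ muP)// (objective_eq _ _ _ _ _ mu'P)//.
  apply: (objective_le mphi phi_ge0 phi1 U0 c0_bounds mc0 T0 VL) => // m A mA.
  have mC : measurable (A `&` cell Q m) by apply: measurableI => //; exact: (Qc m).1.
  by have := close _ mC; rewrite !setIT -!muP// -!mu'P.
Qed.

Lemma objective_attains_inf k (mu : set X -> \bar R) (P : probability X R) :
  (forall A, measurable A -> mu A = P A) ->
  (forall a : 'rV[R]_d.+1, dotp a a = 1%R -> P [set x | dotp a (lift1 x) = 0%R] = 0) ->
  exists2 Q : X -> 'I_M, inQc Q &
    objective lam phi c0 T (Jrem lam phi c0 M T k) mu Q = Jrem lam phi c0 M T k.+1 mu.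
Proof.
move=> muP Pnull; have [Bd [L [Bd0 L0 VL]]] := Jrem_tv_lipschitz k.
have B0 : (0 <= B)%R.
  by have [u _] := U0; have /andP[] := c0_bounds [tuple 0%R | _ < d] u; exact: le_trans.
have [Bd' [L' [_ _ [V'b _]]]] := Jrem_tv_lipschitz k.+1.
have /andP[J0 JB] := V'b mu (ex_intro _ P muP).
have Jfin : Jrem lam phi c0 M T k.+1 mu \is a fin_num.
  by rewrite ge0_fin_numE// (le_lt_trans JB)// ltry.
pose V := Jrem lam phi c0 M T k.
have /choice[Q_ hQ] : forall n : nat, exists Q : X -> 'I_M, inQc Q /\
    objective lam phi c0 T V mu Q < Jrem lam phi c0 M T k.+1 mu + (n.+1%:R^-1)%:E.
  move=> n; have n0 : (0 < n.+1%:R^-1 :> R)%R by rewrite invr_gt0.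
  have [_ [Q Qc <-] hQ] := lb_ereal_inf_adherent n0 Jfin.
  by exists Q.
have [Q Qc QP] := convex_quantizer_compact_measure Pnull (fun n => (hQ n).1).
exists Q => //; apply/eqP; rewrite eq_le; apply/andP; split; last first.
  by apply: ereal_inf_lbound; exists Q.
apply/lee_addgt0Pr => e e0.
pose K := step_lip (M := M) B Bd L.
have K0 : (0 <= K)%R by rewrite /K /step_lip mulr_ge0// !addr_ge0// mulr_ge0.
(* Half of e pays for the disagreement, since K dl is at most e/2; the indices past 2/e make the
   optimality gap at most the other half. *)
have dl0 : (0 < e / 2 / (K + 1))%R by rewrite !divr_gt0// ltr_wpDl.
have [n Nn Pn] := QP _ (Num.truncn (2 / e)) dl0.
have close m : close_on P P (cell Q m) (cell (Q_ n) m) (e / 2 / (K + 1)).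
  by apply: close_on_sym; apply: close_on_neq => //; exact: (hQ n).1.
have := objective_le mphi phi_ge0 phi1 U0 c0_bounds mc0 T0 VL Bd0 L0 (ltW dl0) Qc (hQ n).1 close.
rewrite -!(objective_eq _ _ _ _ _ muP)//; last exact: (hQ n).1.
move=> /le_trans; apply.
apply: (@le_trans _ _ ((Jrem lam phi c0 M T k.+1 mu + (e / 2)%:E) + (e / 2)%:E)).
  apply: leeD.
    apply: le_trans (ltW (hQ n).2) _; rewrite leeD2l// lee_fin.
    rewrite invf_ple ?posrE ?divr_gt0//; rewrite invf_div.
    by apply: le_trans (ltW (truncnS_gt _)) _; rewrite ler_nat ltnS.
  by rewrite lee_fin mulrCA ger_pMr ?divr_gt0// ler_pdivrMr ?ltr_wpDl// mul1r lerDl.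
by rewrite -addeA -EFinD -splitr.
Qed.

(** Only the cell holding x0 has mass, and its filter is the law with density [phi x0]; hence the
    right-hand side is free of Q. *)
Lemma objective_dirac (V : (set X -> \bar R) -> \bar R) (x0 : X) (Q : X -> 'I_M) : inQc Q ->
  objective lam phi c0 T V (dirac x0) Q =
  (T%:R^-1)%:E * ereal_inf [set (c0 x0 u)%:E | u in [set: U]] +
  V (fun A => \int[lam]_(z in A) (phi x0 z)%:E).
Proof.
move=> Qc; have mQ m : measurable (cell Q m) by exact: (Qc m).1.
have dE m : (\d_x0 (cell Q m) : \bar R) = (m == Q x0)%:R%:E.
  rewrite diracE; congr ((nat_of_bool _)%:R%:E); apply/idP/eqP; by rewrite inE /cell/=.
rewrite /objective /cost; congr (_ * _ + _).
  rewrite (bigD1 (Q x0))//= big1 ?adde0 => [|m mQx0].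
    congr ereal_inf; apply: eq_imagel => u _.
    rewrite integral_dirac//; last exact/measurable_EFinP/measurable_funTS.
    by rewrite dE eqxx mul1e.
  (* A massless cell costs the infimum of {0}; a point of [U] is what keeps this set from being
     empty. *)
  rewrite (_ : [set _ | _ in _] = [set 0]) ?ereal_inf1//.
  have [u0 _] := U0.
  apply/seteqP; split => [_ [u _ <-]|_ ->] /=; [|exists u0 => //];
    rewrite integral_dirac ?dE ?(negbTE mQx0) ?mul0e//;
    exact/measurable_EFinP/measurable_funTS.
rewrite (bigD1 (Q x0))//= big1 ?adde0 => [|m mQx0].
  rewrite dE eqxx eqe oner_eq0 mule1; congr V; apply/funext => A.
  rewrite /filter_update dE eqxx /= invr1 mul1e; apply: eq_integral => z _.
  rewrite integral_dirac//; first by rewrite dE eqxx mul1e.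
  apply/measurable_EFinP/measurable_funTS.
  exact: (measurable_fun_pair1 z mphi).
by rewrite dE (negbTE mQx0) eqxx.
Qed.

Lemma objective_attains_inf_dirac k (x0 : X) :
  exists2 Q : X -> 'I_M, inQc Q &
    objective lam phi c0 T (Jrem lam phi c0 M T k) (dirac x0) Q = Jrem lam phi c0 M T k.+1 (dirac x0).
Proof.
have cQ : inQc Qcst by exact: constant_quantizer.
exists Qcst => //=; apply/eqP; rewrite eq_le; apply/andP; split.
  by apply: le_ereal_inf_tmp => _ [Q Qc <-]; rewrite !objective_dirac.
by apply: ereal_inf_lbound; exists Qcst.
Qed.

End bellman_recursion.

(** * Continuity, and assembly of the theorem *)

Lemma tv_lipschitz_continuous (R : realType) d (X : measurableType d)
    (V : (set X -> \bar R) -> \bar R) (Bd L : R) (mu mu' : set X -> \bar R) (e : R) :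
  0 <= L -> 0 < e -> tv_lipschitz V Bd L -> is_prob mu -> is_prob mu' ->
  (forall A, measurable A -> (`|mu A - mu' A| <= (e / (L + 1))%:E)%E) ->
  (`|V mu' - V mu| <= e%:E)%E.
Proof.
move=> L0 e0 [Vb VL] hmu hmu' close.
have dl0 : 0 <= e / (L + 1) by rewrite divr_ge0 ?addr_ge0// ltW.
have [P muP] := hmu; have [P' mu'P] := hmu'.
have cl : close_on mu mu' setT setT (e / (L + 1)).
  move=> A mA; rewrite !setIT; have := close A mA; rewrite muP// mu'P//.
  rewrite -(fineK (fin_num_measure P A mA)) -(fineK (fin_num_measure P' A mA)).
  by rewrite -EFinB abse_EFin -!EFinD !lee_fin ler_norml => /andP[h1 h2]; split; lra.
have /andP[V0 VB] := Vb _ hmu; have /andP[V'0 V'B] := Vb _ hmu'.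
have Le : L * (e / (L + 1)) <= e.
  by rewrite mulrCA ger_pMr// ler_pdivrMr ?ltr_wpDl// mul1r lerDl.
have h1 := VL _ _ _ hmu hmu' dl0 cl.
have h2 := VL _ _ _ hmu' hmu dl0 (close_on_sym cl).
have Vfin : V mu \is a fin_num by rewrite ge0_fin_numE// (le_lt_trans VB)// ltry.
have V'fin : V mu' \is a fin_num by rewrite ge0_fin_numE// (le_lt_trans V'B)// ltry.
move: h1 h2; rewrite -(fineK Vfin) -(fineK V'fin) -EFinB abse_EFin -!EFinD !lee_fin => h1 h2.
by rewrite ler_norml; apply/andP; split; lra.
Qed.

Theorem theorem10 (R : realType) (d M T : nat)
  (lam : {measure set (d.-tuple R) -> \bar R})
  (W : probability (d.-tuple R) R)          (* law of w_0 *)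
  (f : d.-tuple R -> d.-tuple R -> d.-tuple R)
  (phi : d.-tuple R -> d.-tuple R -> R)     (* phi x z = phi(z | x) *)
  (C C1 : R)
  (U : topologicalType) (c0 : d.-tuple R -> U -> R)
  (pi0 : probability (d.-tuple R) R) :
  (0 < d)%N -> (0 < M)%N -> (1 <= T)%N ->
  is_lebesgue lam ->
  (* Assumption 1 *)
  measurable_fun [set: d.-tuple R * d.-tuple R] (fun p => f p.1 p.2) ->
  (forall x A, measurable A ->
     W (f x @^-1` A) = (\int[lam]_(z in A) (phi x z)%:E)%E) ->
  (forall x z, 0 < phi x z) ->
  (forall x z, phi x z <= C) ->
  (forall x, lipschitz_eucl (phi x) C1) ->
  (* Assumption 2 *)
  (forall x u, 0 <= c0 x u) ->
  (exists B : R, forall x u, c0 x u <= B) ->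
  jcont c0 ->
  compact [set: U] -> [set: U] !=set0 ->
  (* initial distribution *)
  ((exists g, has_density lam pi0 g) \/
   (exists x0 : d.-tuple R, (pi0 : set _ -> \bar R) = dirac x0)) ->
  (* the infimum is attained *)
  (forall t pi, (t < T)%N ->
     (inS lam C C1 pi \/ (t = 0%N /\ pi = (pi0 : set _ -> \bar R))) ->
     exists2 Q : d.-tuple R -> 'I_M, inQc Q &
       objective lam phi c0 T (J lam phi c0 M T t.+1) pi Q
       = J lam phi c0 M T t pi)
  /\
  (* J^T_t is continuous on S (total variation / weak topology) *)
  (forall t, (t <= T)%N ->
     forall pi, inS lam C C1 pi ->
     forall e : R, 0 < e -> exists2 del : R, 0 < del &
       forall pi', inS lam C C1 pi' ->
         (forall A, measurable A -> (`|pi A - pi' A| <= del%:E)%E) ->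
         (`|J lam phi c0 M T t pi' - J lam phi c0 M T t pi| <= e%:E)%E).
Proof.
move=> d0 M0 T0 hlam mf fphi phi_gt0 phiC phi_lip c0_ge0 [B c0B] c0_cont _ U0 hpi0.
have mphi := measurable_joint_density hlam mf fphi phi_gt0 phi_lip.
have phi1 x : (\int[lam]_z (phi x z)%:E = 1)%E.
  by rewrite -fphi// preimage_setT probability_setT.
have phi_ge0 x z : 0 <= phi x z by exact: ltW.
have c0_bounds x u : 0 <= c0 x u <= B by rewrite c0_ge0 c0B.
have mc0 u : measurable_fun [set: d.-tuple R] (c0 ^~ u).
  apply: eucl_continuous_measurable => x e e0.
  have [del del0 [N xN h]] := c0_cont x u e e0.
  by exists del => // y xy; apply: h => //; exact: nbhs_singleton.
(* An element of S is a bare set function fixed on measurable sets by its density; the density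
   produces a probability agreeing with it there. *)
have inS_prob mu : inS lam C C1 mu ->
    exists2 P : probability (d.-tuple R) R, (forall A, measurable A -> mu A = P A) &
      exists g, has_density lam P g.
  move=> [mu1 [g [[mg [g0 muE]] _]]].
  have [|||P PE] := @density_probability _ _ R lam (EFin \o g).
  - exact/measurable_EFinP.
  - by move=> x; rewrite lee_fin.
  - by rewrite -muE.
  exists P => [A mA|]; first by rewrite muE// PE.
  by exists g.
have density_null (P : probability (d.-tuple R) R) : (exists g, has_density lam P g) ->
    forall a : 'rV[R]_d.+1, dotp a a = 1 -> P [set x | dotp a (lift1 x) = 0] = 0%E.
  move=> [g [mg [_ PE]]] a a1; apply: (absolutely_continuous_negligible mg PE).
    have := @measurable_dotp_lift1 R d a measurableT [set 0] (measurable_set1 0).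
    by rewrite setTI; congr measurable.
  apply/negligibleP; last exact: lift1_hyperplane_null.
  have := @measurable_dotp_lift1 R d a measurableT [set 0] (measurable_set1 0).
  by rewrite setTI; congr measurable.
have [lam' lamE] := sigma_finite_measure_of (lebesgue_sigma_finite hlam).
have phi1' x : (\int[lam']_z (phi x z)%:E = 1)%E by rewrite -lamE.
split => [t mu tT hmu|t tT mu hmu e e0].
  (* As t < T, the number T - t of remaining stages is a successor, which exposes one Bellman
     step. *)
  rewrite /J -(subnSK tT) lamE.
  have attained (P : probability (d.-tuple R) R) nu : (forall A, measurable A -> nu A = P A) ->
      (exists g, has_density lam P g) ->
      exists2 Q : d.-tuple R -> 'I_M, inQc Q &
        objective lam' phi c0 T (Jrem lam' phi c0 M T (T - t.+1)) nu Q =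
        Jrem lam' phi c0 M T (T - t.+1).+1 nu.
    move=> nuP /density_null Pnull.
    exact: (objective_attains_inf mphi phi_ge0 phi1' U0 c0_bounds mc0 T0 M0 _ nuP).
  case: hmu => [/inS_prob[P muP Pg]|[_ ->]]; first exact: (attained P).
  case: hpi0 => [pi0g|[x0 ->]]; first exact: (attained pi0).
  exact: (objective_attains_inf_dirac lam' mphi T U0 mc0 M0).
have [Bd [L [_ L0 VL]]] :=
  Jrem_tv_lipschitz mphi phi_ge0 phi1' U0 c0_bounds mc0 T0 M0 (T - t).
exists (e / (L + 1)); first by rewrite divr_gt0// ltr_wpDl.
move=> mu' hmu' close; rewrite /J lamE.
have is_prob_inS nu : inS lam C C1 nu -> is_prob nu by move=> /inS_prob[P nuP _]; exists P.
by apply: (tv_lipschitz_continuous L0 e0 VL _ _ close); exact: is_prob_inS.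
Qed.
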